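(* The algorithm described in the context (operation kscd_broadcast and background task $T$) implements $k$-SCD-broadcast from $k$-set agreement and snapshot objects.
   Context: Model: $n$ asynchronous sequential processes $p_1,\dots,p_n$; up to $n-1$ may crash in a run (a process that crashes is faulty, otherwise it is non-faulty; a process executes its local algorithm correctly until its possible crash). All messages that are broadcast are assumed different. $k$-SCD-broadcast provides the operations kscd_broadcast$(m)$ and kscd_deliver$()$, the latter returning a non-empty set of messages; a process ''kscd-delivers a message $m$'' when it delivers a message set containing $m$. Properties: - KSCD-Validity: if a process kscd-delivers a set containing a message $m$, then $m$ was kscd-broadcast by some process. - KSCD-Integrity: a message is kscd-delivered at most once by each process. - KSCD-Ordering: if a process $p_i$ kscd-delivers first a message $m$ belonging to a set $ms_i$ and later a message $m'$ belonging to a set $ms_i'\neq ms_i$, then no process kscd-delivers first the message $m'$ in some kscd-delivered set $ms_j'$ and later the message $m$ in some kscd-delivered set $ms_j\ne ms_j'$. - KSCD-Termination-1: if a non-faulty process kscd-broadcasts a message $m$, it terminates its kscd-broadcast invocation and kscd-delivers a message set containing $m$. - KSCD-Termination-2: if a process kscd-delivers a message set containing $m$, every non-faulty process kscd-delivers a message set containing $m$. - KSCD-Bounded: no message set kscd-delivered to a process contains more than $k$ messages. Base objects. $k$-set agreement object: one-shot operation propose$(v)$; a decided (returned) value was proposed by a process; at most $k$ different values are decided; every non-faulty process (that invokes propose) decides a value. Snapshot object: array of $n$ single-writer/multi-reader registers with atomic (linearizable) operations write$(v)$ (by $p_i$: assigns $v$ to entry $i$) and snapshot$()$ (returns the full array);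 it is one-shot if each process invokes each operation once, first write and then snapshot, and multi-shot if there is no restriction on the number of invocations. Entries are initially $\bot$. Repeated K2S object $\mathit{KSS}$: with each instance number $r$ are associated a $k$-set agreement instance $\mathit{KSET}_r$ and two one-shot snapshot objects $\mathit{SNAP1}_r,\mathit{SNAP2}_r$. $\mathit{KSS}.$k2s_propose$(r,v)$ by $p_i$: $val_i\leftarrow \mathit{KSET}_r.\mathrm{propose}(v)$; $\mathit{SNAP1}_r.\mathrm{write}(val_i)$; $snap1_i\leftarrow \mathit{SNAP1}_r.\mathrm{snapshot}()$; $view_i\leftarrow\{snap1_i[j]: snap1_i[j]\neq\bot\}$; $\mathit{SNAP2}_r.\mathrm{write}(view_i)$; $snap2_i\leftarrow \mathit{SNAP2}_r.\mathrm{snapshot}()$; $sets_i\leftarrow\{snap2_i[j]: snap2_i[j]\ne\bot\}$; return $sets_i$. Algorithm, code for $p_i$. Shared: $\mathit{KSS}$, and a multi-shot snapshot object $\mathit{MEM}[1..n]$ such that $\mathit{MEM}[i]$ contains the set of messages kscd-broadcast by $p_i$. Local: $mem1_i,mem2_i$ (local copies of $\mathit{MEM}$, $mem1_i[i]$ initialized to $\emptyset$), $delivered_i$ (the set of messages locally kscd-delivered, initially empty), $seq_i$ and $new\_seq_i$ (sequences of message sets, initially the empty sequence $\epsilon$). $\oplus$ is sequence concatenation; head$(sq)$ is the first element of the sequence $sq$ and tail$(sq)$ is $sq$ without its first element. Operation kscd_broadcast$(m)$: $\mathit{MEM}.\mathrm{write}(mem1_i[i]\cup\{m\})$; $mem1_i\leftarrow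 \mathit{MEM}.\mathrm{snapshot}()$; $to\_deliver1_i\leftarrow(\bigcup_{1\le j\le n}mem1_i[j])\setminus delivered_i$; wait until $to\_deliver1_i\subseteq delivered_i$. Background task $T$: repeat forever: (1) $prop_i\leftarrow\bot$. If $seq_i=\epsilon$: $mem2_i\leftarrow \mathit{MEM}.\mathrm{snapshot}()$; $to\_deliver2_i\leftarrow(\bigcup_{1\le j\le n} mem2_i[j])\setminus delivered_i$; if $to\_deliver2_i\ne\emptyset$ then $prop_i\leftarrow$ a message of $to\_deliver2_i$. Else: $prop_i\leftarrow$ a message of the first message set of $seq_i$. (2) If $prop_i\ne\bot$: (a) $r_i\leftarrow|delivered_i|$; $sets_i\leftarrow \mathit{KSS}.$k2s_propose$(r_i,prop_i)$; $new\_seq_i\leftarrow\epsilon$. (b) While $sets_i\neq\{\emptyset\}$: $min\_set_i\leftarrow$ non-empty set of minimal size in $sets_i$; $new\_seq_i\leftarrow new\_seq_i\oplus min\_set_i$; for each set $s\in sets_i$ do $sets_i\leftarrow(sets_i\setminus\{s\})\cup\{s\setminus min\_set_i\}$. (c) Let $aux_i$ be all the messages in the sets of $new\_seq_i$; for each set $s\in seq_i$ do $s\leftarrow s\setminus aux_i$. (d) $seq_i\leftarrow new\_seq_i\oplus seq_i$; let $first_i=\mathrm{head}(seq_i)$ and $rest_i=\mathrm{tail}(seq_i)$; kscd_deliver$(first_i)$; $delivered_i\leftarrow delivered_i\cup first_i$; $seq_i\leftarrow rest_i$.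
   Formalization: In line (c), message sets of seq_i that become empty after subtracting aux_i are removed from the sequence; kept literally, an empty first set would leave ''a message of the first message set of seq_i'' undefined and block task T. *)

(* Defs.v *)
From mathcomp Require Import all_boot finmap.

Set Implicit Arguments.
Unset Strict Implicit.
Unset Printing Implicit Defensive.

Local Open Scope fset_scope.

Definition upd (A : eqType) (B : Type) (f : A -> B) (a : A) (b : B) : A -> B :=
  fun x => if x == a then b else f x.

(** * Specification of the broadcast abstraction *)

(* [Deliver i ms] : an invocation of kscd_deliver by process i returns ms. *)
Inductive event (n : nat) (M : choiceType) : Type :=
| Broadcast of 'I_n & M
| BroadcastReturn of 'I_n & M
| Deliver of 'I_n & {fset M}.

(* [h t] is the interface event occurring at time t, if there is one. *)
Definition history (n : nat) (M : choiceType) := nat -> option (event n M).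

Section Specification.
Variables (n k : nat) (M : choiceType).
Variables (nonfaulty : 'I_n -> Prop) (h : history n M).

Definition distinct_broadcasts : Prop :=
  forall t t' i j m,
    h t = Some (Broadcast i m) -> h t' = Some (Broadcast j m) -> t = t'.

Definition kscd_nonempty : Prop :=
  forall t i ms, h t = Some (Deliver i ms) -> ms != fset0.

Definition kscd_validity : Prop :=
  forall t i ms m, h t = Some (Deliver i ms) -> m \in ms ->
    exists t' j, t' < t /\ h t' = Some (Broadcast j m).

Definition kscd_integrity : Prop :=
  forall t t' i ms ms' m,
    h t = Some (Deliver i ms) -> m \in ms ->
    h t' = Some (Deliver i ms') -> m \in ms' -> t = t'.

Definition delivers_before (i : 'I_n) (m m' : M) : Prop :=
  exists t t' ms ms', [/\ t < t',
    h t = Some (Deliver i ms) /\ m \in ms,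
    h t' = Some (Deliver i ms') /\ m' \in ms' & ms != ms'].

Definition kscd_ordering : Prop :=
  forall i m m', delivers_before i m m' -> ~ exists j, delivers_before j m' m.

Definition kscd_termination1 : Prop :=
  forall t i m, nonfaulty i -> h t = Some (Broadcast i m) ->
    (exists t', t < t' /\ h t' = Some (BroadcastReturn i m)) /\
    (exists t' ms, h t' = Some (Deliver i ms) /\ m \in ms).

Definition kscd_termination2 : Prop :=
  forall t j ms m, h t = Some (Deliver j ms) -> m \in ms ->
    forall i, nonfaulty i ->
      exists t' ms', h t' = Some (Deliver i ms') /\ m \in ms'.

Definition kscd_bounded : Prop :=
  forall t i ms, h t = Some (Deliver i ms) -> #|` ms| <= k.

Record kscd_broadcast_spec : Prop := KscdBroadcastSpec {
  spec_nonempty : kscd_nonempty;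
  spec_validity : kscd_validity;
  spec_integrity : kscd_integrity;
  spec_ordering : kscd_ordering;
  spec_termination1 : kscd_termination1;
  spec_termination2 : kscd_termination2;
  spec_bounded : kscd_bounded
}.

End Specification.

(** * Base objects *)

(* A k-set agreement object is not atomic: the invocation of propose and the
   decision are two separate steps.  [kset_decides] is the set of responses
   that the object may give; the choice among them is adversarial. *)
Record kset_object (M : choiceType) := KSetObject {
  proposed : {fset M};
  decided : {fset M}
}.

Definition kset_init (M : choiceType) : kset_object M := KSetObject fset0 fset0.

Definition kset_propose (M : choiceType) (o : kset_object M) (v : M) :=
  KSetObject (v |` proposed o) (decided o).

Definition kset_decides (k : nat) (M : choiceType) (o : kset_object M)
    (v : M) (o' : kset_object M) : Prop :=
  [/\ v \in proposed o, #|` v |` decided o| <= k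
    & o' = KSetObject (proposed o) (v |` decided o)].

(* Snapshot objects are linearizable, so write and snapshot are single steps;
   None is the initial value of an entry. *)
Definition snapshot_object (n : nat) (T : Type) := 'I_n -> option T.

Definition snapshot_init (n : nat) (T : Type) : snapshot_object n T :=
  fun=> None.

Arguments snapshot_init {n T}.

Definition snapshot_write (n : nat) (T : Type) (o : snapshot_object n T)
    (i : 'I_n) (v : T) : snapshot_object n T := upd o i (Some v).

Definition entries (n : nat) (T : choiceType) (o : snapshot_object n T) :
    {fset T} :=
  [fset x in pmap o (enum 'I_n)].

(* An entry that was never written counts as the empty set of messages. *)
Definition union_entries (n : nat) (M : choiceType)
    (o : snapshot_object n {fset M}) : {fset M} :=
  \bigcup_(j in 'I_n) odflt fset0 (o j).

(** * The algorithm *)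

Section Algorithm.
Variables (n k : nat) (M : choiceType).

(* Control points of kscd_broadcast; those between the invocation and the
   return carry the message being broadcast. *)
Inductive op_pc :=
| OpIdle
| OpWrite of M
| OpSnapshot of M
| OpPending of M
| OpWait of M & {fset M}.

Record op_state := OpState {
  opc : op_pc;
  mem1 : snapshot_object n {fset M}
}.

(* Control points of the background task, with the values of the local
   variables that are live there.  They are named after the next action; the
   natural number is the instance r in use. *)
Inductive task_pc :=
| TkLoop
| TkPropose of M
| TkDecide of nat
| TkWrite1 of nat & M
| TkSnap1 of nat
| TkWrite2 of nat & {fset M}
| TkSnap2 of nat
| TkOrder of {fset {fset M}}.

Record task_state := TaskState {
  tpc : task_pc;
  delivered : {fset M};
  msg_seq : seq {fset M}
}.

Record state := State {
  op : 'I_n -> op_state;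
  task : 'I_n -> task_state;
  MEM : snapshot_object n {fset M};
  KSET : nat -> kset_object M;
  SNAP1 : nat -> snapshot_object n M;
  SNAP2 : nat -> snapshot_object n {fset M}
}.

Definition init_state : state := State
  (fun i => OpState OpIdle (upd (snapshot_init) i (Some fset0)))
  (fun=> TaskState TkLoop fset0 [::])
  (snapshot_init)
  (fun=> kset_init M)
  (fun=> snapshot_init)
  (fun=> snapshot_init).

Definition set_op (s : state) (i : 'I_n) (p : op_state) :=
  State (upd (op s) i p) (task s) (MEM s) (KSET s) (SNAP1 s) (SNAP2 s).
Definition set_task (s : state) (i : 'I_n) (p : task_state) :=
  State (op s) (upd (task s) i p) (MEM s) (KSET s) (SNAP1 s) (SNAP2 s).
Definition set_tpc (s : state) (i : 'I_n) (c : task_pc) :=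
  set_task s i (TaskState c (delivered (task s i)) (msg_seq (task s i))).
Definition set_MEM (s : state) (o : snapshot_object n {fset M}) :=
  State (op s) (task s) o (KSET s) (SNAP1 s) (SNAP2 s).
Definition set_KSET (s : state) (r : nat) (o : kset_object M) :=
  State (op s) (task s) (MEM s) (upd (KSET s) r o) (SNAP1 s) (SNAP2 s).
Definition set_SNAP1 (s : state) (r : nat) (o : snapshot_object n M) :=
  State (op s) (task s) (MEM s) (KSET s) (upd (SNAP1 s) r o) (SNAP2 s).
Definition set_SNAP2 (s : state) (r : nat) (o : snapshot_object n {fset M}) :=
  State (op s) (task s) (MEM s) (KSET s) (SNAP1 s) (upd (SNAP2 s) r o).

(* [split_sets sets q] : the while loop, started on [sets] with an empty
   new_seq, may end with new_seq = q.  Since (s \ min) \ min = s \ min, the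
   inner "for each" loop amounts to taking the image of the set. *)
Inductive split_sets : {fset {fset M}} -> seq {fset M} -> Prop :=
| split_sets_done : split_sets [fset fset0] [::]
| split_sets_step sets ms q :
    sets != [fset fset0] ->
    ms \in sets -> ms != fset0 ->
    (forall s, s \in sets -> s != fset0 -> #|` ms| <= #|` s|) ->
    split_sets [fset s `\` ms | s in sets] q ->
    split_sets sets (ms :: q).

(* Message sets are non-empty: a set emptied by the removal of the messages of
   new_seq is no longer an element of the sequence. *)
Definition merge_seq (new_sq sq : seq {fset M}) : seq {fset M} :=
  let aux := \bigcup_(s <- new_sq) s in
  new_sq ++ [seq s <- [seq s `\` aux | s <- sq] | s != fset0].

Inductive oneshot_op :=
| KSetPropose | Snap1Write | Snap1Snapshot | Snap2Write | Snap2Snapshot.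

(* [OneShotOp i r o] : process i invokes the operation o of instance r. *)
Inductive action :=
| Interface of event n M
| OneShotOp of 'I_n & nat & oneshot_op
| Internal.

(* The invocation of kscd_broadcast is decided by the client of the process,
   which is sequential. *)
Inductive client_step (i : 'I_n) : action -> state -> state -> Prop :=
| client_invoke s m :
    opc (op s i) = OpIdle ->
    client_step i (Interface (Broadcast i m)) s
      (set_op s i (OpState (OpWrite m) (mem1 (op s i)))).

Inductive op_step (i : 'I_n) : action -> state -> state -> Prop :=
| op_write s m :
    opc (op s i) = OpWrite m ->
    op_step i Internal s
      (set_op
        (set_MEM s (snapshot_write (MEM s) i
                      (odflt fset0 (mem1 (op s i) i) `|` [fset m])))
        i (OpState (OpSnapshot m) (mem1 (op s i))))
| op_snapshot s m :
    opc (op s i) = OpSnapshot m ->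
    op_step i Internal s (set_op s i (OpState (OpPending m) (MEM s)))
| op_pending s m :
    opc (op s i) = OpPending m ->
    op_step i Internal s
      (set_op s i
        (OpState
          (OpWait m (union_entries (mem1 (op s i)) `\` delivered (task s i)))
          (mem1 (op s i))))
| op_return s m to_deliver1 :
    opc (op s i) = OpWait m to_deliver1 ->
    to_deliver1 `<=` delivered (task s i) ->
    op_step i (Interface (BroadcastReturn i m)) s
      (set_op s i (OpState OpIdle (mem1 (op s i)))).

Inductive task_step (i : 'I_n) : action -> state -> state -> Prop :=
| task_none s :
    tpc (task s i) = TkLoop ->
    msg_seq (task s i) = [::] ->
    union_entries (MEM s) `\` delivered (task s i) = fset0 ->
    task_step i Internal s s
| task_from_mem s v :
    tpc (task s i) = TkLoop ->
    msg_seq (task s i) = [::] ->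
    v \in union_entries (MEM s) `\` delivered (task s i) ->
    task_step i Internal s (set_tpc s i (TkPropose v))
| task_from_seq s ms q v :
    tpc (task s i) = TkLoop ->
    msg_seq (task s i) = ms :: q ->
    v \in ms ->
    task_step i Internal s (set_tpc s i (TkPropose v))
| task_propose s v r :
    tpc (task s i) = TkPropose v ->
    r = #|` delivered (task s i)| ->
    task_step i (OneShotOp i r KSetPropose) s
      (set_tpc (set_KSET s r (kset_propose (KSET s r) v)) i (TkDecide r))
| task_decide s r val o :
    tpc (task s i) = TkDecide r ->
    kset_decides k (KSET s r) val o ->
    task_step i Internal s (set_tpc (set_KSET s r o) i (TkWrite1 r val))
| task_write1 s r val :
    tpc (task s i) = TkWrite1 r val ->
    task_step i (OneShotOp i r Snap1Write) s
      (set_tpc (set_SNAP1 s r (snapshot_write (SNAP1 s r) i val))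
        i (TkSnap1 r))
| task_snap1 s r :
    tpc (task s i) = TkSnap1 r ->
    task_step i (OneShotOp i r Snap1Snapshot) s
      (set_tpc s i (TkWrite2 r (entries (SNAP1 s r))))
| task_write2 s r view :
    tpc (task s i) = TkWrite2 r view ->
    task_step i (OneShotOp i r Snap2Write) s
      (set_tpc (set_SNAP2 s r (snapshot_write (SNAP2 s r) i view))
        i (TkSnap2 r))
| task_snap2 s r :
    tpc (task s i) = TkSnap2 r ->
    task_step i (OneShotOp i r Snap2Snapshot) s
      (set_tpc s i (TkOrder (entries (SNAP2 s r))))
| task_deliver s sets new_sq first rest :
    tpc (task s i) = TkOrder sets ->
    split_sets sets new_sq ->
    merge_seq new_sq (msg_seq (task s i)) = first :: rest ->
    task_step i (Interface (Deliver i first)) s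
      (set_task s i
        (TaskState TkLoop (delivered (task s i) `|` first) rest)).

(** * Runs *)

(* Operation and Task are the two local programs of a process, which
   interleave freely; Client invokes kscd_broadcast. *)
Inductive activity := Client | Operation | Task.

Definition step (i : 'I_n) (a : activity) : action -> state -> state -> Prop :=
  match a with
  | Client => client_step i
  | Operation => op_step i
  | Task => task_step i
  end.

Definition enabled (i : 'I_n) (a : activity) (s : state) : Prop :=
  exists x s', step i a x s s'.

(* The step from [st t] to [st t.+1] is a step of activity [active t] of
   process [actor t], and performs [act t].  [crash i] is the time from which
   i takes no more steps, or None if i does not crash. *)
Record execution := Execution {
  st : nat -> state;
  actor : nat -> 'I_n;
  active : nat -> activity;
  act : nat -> action;
  crash : 'I_n -> option nat
}.

Definition nonfaulty (e : execution) (i : 'I_n) : Prop := crash e i = None.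

(* Runs are infinite, as a process that does not crash repeats its background
   task forever.  In [run_fair], an activity other than Client is not
   neglected forever while it is able to progress; in particular a non-faulty
   process that proposes to a k-set agreement object eventually decides. *)
Record is_run (e : execution) : Prop := IsRun {
  run_init : st e 0 = init_state;
  run_step : forall t,
    step (actor e t) (active e t) (act e t) (st e t) (st e t.+1);
  run_crash : forall t c, crash e (actor e t) = Some c -> t < c;
  run_resilience : #|[set i | crash e i]| <= n.-1;
  run_fair : forall i a, nonfaulty e i -> a <> Client ->
    forall t, exists t', t <= t' /\
      ((actor e t' = i /\ active e t' = a) \/ ~ enabled i a (st e t'))
}.

Definition history_of (e : execution) : history n M :=
  fun t => if act e t is Interface ev then Some ev else None.

(* The one-shot objects are used as they must be: each process invokes each
   operation of an instance at most once, and write before snapshot. *)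
Definition one_shot_use (e : execution) : Prop :=
  [/\ forall t t' i r o,
        act e t = OneShotOp i r o -> act e t' = OneShotOp i r o -> t = t',
      forall t i r, act e t = OneShotOp i r Snap1Snapshot ->
        exists t', t' < t /\ act e t' = OneShotOp i r Snap1Write
    & forall t i r, act e t = OneShotOp i r Snap2Snapshot ->
        exists t', t' < t /\ act e t' = OneShotOp i r Snap2Write].

End Algorithm.

Arguments init_state {n M}.
Arguments TkLoop {M}.
Arguments OpIdle {M}.
Arguments Internal {n M}.

(* Main.v *)
Require Import Defs.
From mathcomp Require Import all_boot finmap.
From mathcomp Require Import zify.
From Stdlib Require Import Classical_Prop.

(** The delivered sets of all processes, at all times, form a chain for
    inclusion.  In instance [r] the views are totally ordered, and so are the
    sets of views, because both come from one-shot snapshots; a process delivers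
    the least view [V] that it got, and one that delivers a smaller view has
    [V] in its set of views and cuts its sequence at [V].  So when a process
    jumps from [q] to [r'] delivered messages, every process passing through a
    size [r] with [q < r <= r'] has the jumper's new delivered set among the
    prefix unions of its own sequence, by strong induction on [r].  Hence the
    processes with [r] delivered messages agree on them, which in turn makes the
    use of the objects of instance [r] one-shot.

    For termination, suppose that a non-faulty process never delivers a message
    [m] of MEM.  It delivers without end, so by the chain property nobody
    delivers [m], and every kscd_broadcast that takes its snapshot late blocks
    on [m].  Then MEM stays bounded, which is absurd. *)

Set Implicit Arguments.
Unset Strict Implicit.
Unset Printing Implicit Defensive.

Local Open Scope fset_scope.
Local Open Scope nat_scope.

(** * Prefix unions of a sequence of message sets *)

Section MessageSets.
Variable M : choiceType.
Implicit Types (D X Y A ms V : {fset M}) (q sq : seq {fset M}).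
Implicit Types (S : {fset {fset M}}).

Definition cuts D q : seq {fset M} := D :: scanl fsetU D q.

Lemma in_cuts_nil D X : (X \in cuts D [::]) = (X == D).
Proof. exact: mem_seq1. Qed.

Lemma in_cuts_cons D ms q X :
  (X \in cuts D (ms :: q)) = (X == D) || (X \in cuts (D `|` ms) q).
Proof. exact: in_cons. Qed.

Lemma cuts_head D q : D \in cuts D q.
Proof. exact: mem_head. Qed.

Lemma cuts_sup D q X : X \in cuts D q -> D `<=` X.
Proof.
elim: q D => [|ms q IH] D; first by rewrite in_cuts_nil => /eqP->.
rewrite in_cuts_cons => /orP[/eqP->//|/IH]; apply: fsubset_trans.
exact: fsubsetUl.
Qed.

Lemma cuts_first D ms q X :
  X \in cuts D (ms :: q) -> X != D -> D `|` ms `<=` X.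
Proof. by rewrite in_cuts_cons => /orP[->//|/cuts_sup]. Qed.

Lemma cuts_cat D q1 q2 X :
  (X \in cuts D q1) || (X \in cuts (D `|` \bigcup_(s <- q1) s) q2) ->
  X \in cuts D (q1 ++ q2).
Proof.
elim: q1 D => [|ms q1 IH] D.
  rewrite big_nil fsetU0 in_cuts_nil => /orP[/eqP->|//]; exact: cuts_head.
rewrite cat_cons !in_cuts_cons big_cons fsetUA -orbA => /orP[->//|h].
by rewrite IH ?orbT.
Qed.

Lemma cuts_subtract D A q X :
  X \in cuts D q ->
  X `|` A \in cuts (D `|` A) [seq s <- [seq s `\` A | s <- q] | s != fset0].
Proof.
elim: q D => [|ms q IH] D; first by rewrite in_cuts_nil => /eqP->; exact: cuts_head.
rewrite in_cuts_cons => /orP[/eqP->|/IH]; first exact: cuts_head.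
have -> : D `|` ms `|` A = D `|` A `|` (ms `\` A).
  apply/fsetP=> x; rewrite !inE.
  by case: (x \in D); case: (x \in ms); case: (x \in A).
move=> h /=; case: (altP eqP) => [e0|_] /=.
  by rewrite e0 fsetU0 in h.
by rewrite in_cuts_cons h orbT.
Qed.

Definition chain S := forall V V', V \in S -> V' \in S -> V `<=` V' \/ V' `<=` V.

Lemma chain_min S ms V :
  chain S -> ms \in S -> (forall s, s \in S -> s != fset0 -> #|` ms| <= #|` s|) ->
  V \in S -> V != fset0 -> ms `<=` V.
Proof.
move=> cS msS minS VS V0; case: (cS _ _ msS VS) => // sub.
have /eqP -> // : V == ms by rewrite eqEfcard sub minS.
Qed.

Lemma chain_subtract S ms : chain S -> chain [fset s `\` ms | s in S].
Proof.
move=> cS _ _ /imfsetP[V VS ->] /imfsetP[V' VS' ->].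
by case: (cS _ _ VS VS') => sub; [left | right]; apply: fsetSD.
Qed.

Lemma split_sets_sub S q : split_sets S q ->
  forall ms, ms \in q -> ms != fset0 /\ exists2 V, V \in S & ms `<=` V.
Proof.
elim=> // {}S ms {}q _ msS ms0 _ _ IH ms'; rewrite inE => /orP[/eqP->|/IH].
  by split=> //; exists ms.
move=> [n0 [_ /imfsetP[V VS ->] sub]]; split=> //; exists V => //.
exact: fsubset_trans sub (fsubsetDl _ _).
Qed.

Lemma split_sets_cuts S q D : split_sets S q -> chain S ->
  forall V, V \in S -> D `|` V \in cuts D q.
Proof.
move=> sq; elim: sq D => [|{}S ms {}q _ msS _ minS _ IH] D cS V VS.
  by move: VS; rewrite !inE => /eqP->; rewrite fsetU0.
have [->|V0] := eqVneq V fset0; first by rewrite fsetU0 cuts_head.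
have sub := chain_min cS msS minS VS V0.
rewrite in_cuts_cons; apply/orP; right.
have -> : D `|` V = D `|` ms `|` (V `\` ms).
  by rewrite -fsetUA fsetUDl fsetDv fsetD0; congr (_ `|` _); apply/esym/fsetUidPr.
apply: IH; first exact: chain_subtract.
by apply/imfsetP; exists V.
Qed.

Lemma split_sets_exists S : S != fset0 -> exists q, split_sets S q.
Proof.
pose U (T : {fset {fset M}}) := \bigcup_(s <- T) s.
move: {2}(#|` U S|.+1) (ltnSn #|` U S|) => N.
elim: N S => // N IH S ltN S0.
have [->|S1] := eqVneq S [fset fset0]; first by exists [::]; constructor.
have [V VS V0] : exists2 V, V \in S & V != fset0.
  case/fset0Pn: S0 => W WS; have [W0|] := eqVneq W fset0; last by exists W.
  have /fsubsetPn[V VS] : ~~ (S `<=` [fset fset0]).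
    apply: contra S1; rewrite fsubset1 => /orP[//|/eqP S0].
    by rewrite S0 inE in WS.
  by rewrite inE; exists V.
have [ms [msS ms0 minS]] : exists ms, [/\ ms \in S, ms != fset0
    & forall s, s \in S -> s != fset0 -> #|` ms| <= #|` s|].
  pose P c := has (fun s => (s != fset0) && (#|` s| == c)) S.
  have exP : exists c, P c.
    by exists #|` V|; apply/hasP; exists V; rewrite ?V0 /=.
  case: (ex_minnP exP) => c /hasP[ms msS /andP[ms0 /eqP cE]] minc.
  exists ms; split=> // s sS s0; rewrite cE minc //.
  by apply/hasP; exists s; rewrite ?s0 /=.
have [q sq] : exists q, split_sets [fset s `\` ms | s in S] q.
  apply: IH; last by apply/fset0Pn; exists (V `\` ms); apply/imfsetP; exists V.
  rewrite -ltnS; apply: leq_trans ltN; rewrite ltnS; apply: fproper_ltn_card.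
  apply: (@fsub_proper_trans _ (U S `\` ms)).
    apply/bigfcupsP => _ /imfsetP[W WS ->] _; apply: fsetSD.
    exact: bigfcup_sup.
  rewrite fproperE fsubsetDl; apply: contra ms0 => /fsubsetP sub.
  apply/eqP/fsetP => x; rewrite [RHS]inE; apply/negP => xms.
  have : x \in U S `\` ms.
    by apply: sub; apply/bigfcupP; exists ms => //; rewrite msS.
  by rewrite inE xms.
by exists (ms :: q); econstructor; eauto.
Qed.

Lemma split_sets_head S q : split_sets S q -> S != fset0 ->
  (forall V, V \in S -> V != fset0) ->
  exists ms q', [/\ q = ms :: q', ms \in S,
    forall V, V \in S -> #|` ms| <= #|` V| &
    split_sets [fset s `\` ms | s in S] q'].
Proof.
case=> [_ /(_ fset0)|{}S ms {}q _ msS _ minS sq _ ne0].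
  by rewrite inE eqxx => /(_ isT).
by exists ms, q; split=> // V VS; apply: minS => //; apply: ne0.
Qed.

Lemma merge_cuts_view S q sq D V : split_sets S q -> chain S -> V \in S ->
  D `|` V \in cuts D (merge_seq q sq).
Proof.
by move=> sS cS VS; apply/cuts_cat/orP; left; apply: split_sets_cuts sS cS _ VS.
Qed.

Lemma merge_cuts_old S q sq D X : split_sets S q -> X \in cuts D sq ->
  (forall V, V \in S -> V `<=` X) -> X \in cuts D (merge_seq q sq).
Proof.
move=> sS /(cuts_subtract (\bigcup_(s <- q) s)) XD sub.
apply/cuts_cat/orP; right; move: XD; rewrite (_ : X `|` _ = X) //.
apply/fsetUidPl/bigfcupsP => ms /(split_sets_sub sS)[_ [V VS msV]] _.
exact: fsubset_trans msV (sub _ VS).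
Qed.

Lemma merge_disjoint S ms q sq D : split_sets [fset s `\` ms | s in S] q ->
  (forall V x, V \in S -> x \in V -> x \notin D) ->
  (forall s x, s \in sq -> x \in s -> x \notin D) ->
  forall rest, merge_seq (ms :: q) sq = ms :: rest ->
  forall s x, s \in rest -> x \in s -> x \notin D `|` ms.
Proof.
move=> sS dS dsq _ [<-] s x; rewrite mem_cat inE negb_or => /orP[].
  move=> /(split_sets_sub sS)[_ [_ /imfsetP[V /= VS ->] /fsubsetP sub]] /sub.
  by rewrite inE => /andP[-> xV]; rewrite andbT; apply: dS VS xV.
rewrite mem_filter => /andP[_ /mapP[s' s'q ->]]; rewrite inE => /andP[xU xs'].
rewrite (dsq _ _ s'q xs') /=; apply: contra xU => xms.
by rewrite big_cons inE xms.
Qed.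

End MessageSets.

(** * Invariants of a step *)

Lemma updE (A : eqType) (B : Type) (f : A -> B) a b x :
  upd f a b x = if x == a then b else f x.
Proof. by []. Qed.

Lemma in_entries n (T : choiceType) (o : snapshot_object n T) x :
  x \in entries o <-> exists j, o j = Some x.
Proof.
rewrite in_fset /= mem_pmap; split=> [/mapP[j _ ->]|[j e]]; first by exists j.
by apply/mapP; exists j; rewrite ?mem_enum.
Qed.

Lemma in_union_entries n (M : choiceType) (o : snapshot_object n {fset M}) x :
  x \in union_entries o <-> exists j, x \in odflt fset0 (o j).
Proof.
split=> [/bigfcupP[j _ xj]|[j xj]]; first by exists j.
by apply/bigfcupP; exists j; rewrite ?mem_index_enum.
Qed.

Lemma union_entries_sub n (M : choiceType)
    (o o' : snapshot_object n {fset M}) :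
  (forall j, odflt fset0 (o j) `<=` odflt fset0 (o' j)) ->
  union_entries o `<=` union_entries o'.
Proof.
move=> sub; apply/fsubsetP => x /in_union_entries[j xj].
by apply/in_union_entries; exists j; apply: (fsubsetP (sub j)).
Qed.

Section Steps.
Variables (n k : nat) (M : choiceType).
Implicit Types (s : state n M) (i j : 'I_n) (m : M) (T : task_state M).

Definition phase (c : task_pc M) : nat :=
  match c with
  | TkLoop => 0 | TkPropose _ => 1 | TkDecide _ => 2 | TkWrite1 _ _ => 3
  | TkSnap1 _ => 4 | TkWrite2 _ _ => 5 | TkSnap2 _ => 6 | TkOrder _ => 7
  end.

Definition op_phase (o : oneshot_op) : nat :=
  match o with
  | KSetPropose => 1 | Snap1Write => 3 | Snap1Snapshot => 4
  | Snap2Write => 5 | Snap2Snapshot => 6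
  end.

Definition delivery j (x : action n M) s s' first : Prop :=
  exists S q rest,
  [/\ x = Interface (Deliver j first), tpc (task s j) = TkOrder S,
      split_sets S q, merge_seq q (msg_seq (task s j)) = first :: rest
    & task s' j = TaskState TkLoop (delivered (task s j) `|` first) rest].

Lemma step_task i a x s s' j : step k i a x s s' ->
  (exists first, delivery j x s s' first) \/
  [/\ forall ms, x <> Interface (Deliver j ms),
      delivered (task s' j) = delivered (task s j),
      msg_seq (task s' j) = msg_seq (task s j)
    & phase (tpc (task s j)) <= phase (tpc (task s' j))].
Proof.
case: a => /=; [case|case|case] => {}s; try by move=> *; right; split.
1-8: move=> *; right; rewrite /= updE; split=> //; case: eqP => // -> /=;
  by match goal with H : tpc _ = _ |- _ => rewrite ?H end.
move=> S q first rest pcE sq mE; have [->|ne] := eqVneq j i.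
  by left; exists first, S, q, rest; rewrite /= updE eqxx.
right; rewrite /= updE (negbTE ne); split=> // ms [ji].
by rewrite ji eqxx in ne.
Qed.

Definition content s j := odflt fset0 (MEM s j).

Definition is_snapshot (c : op_pc M) := if c is OpSnapshot _ then true else false.

Record op_inv s : Prop := OpInv {
  op_own : forall i, ~~ is_snapshot (opc (op s i)) ->
    odflt fset0 (mem1 (op s i) i) = content s i;
  op_copy : forall i j, odflt fset0 (mem1 (op s i) j) `<=` content s j;
  op_wait : forall i m d, opc (op s i) = OpWait m d ->
    d `<=` union_entries (MEM s)
}.

Lemma step_content i a x s s' j : step k i a x s s' -> op_inv s ->
  content s j `<=` content s' j.
Proof.
case: a => /=; [case|case|case] => {}s; try by [].
move=> m pcE /op_own own; rewrite /content /= /snapshot_write updE.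
case: eqP => // -> /=; rewrite own ?pcE //; exact: fsubsetUl.
Qed.

Lemma step_op_inv i a x s s' : step k i a x s s' -> op_inv s -> op_inv s'.
Proof.
move=> st inv; have mon j := step_content j st inv.
case: inv => own copy wait.
have copy' i' j : odflt fset0 (mem1 (op s i') j) `<=` content s' j.
  exact: fsubset_trans (copy _ _) (mon j).
have wait' i' m d : opc (op s i') = OpWait m d -> d `<=` union_entries (MEM s').
  by move=> /wait h; apply: (fsubset_trans h); apply: union_entries_sub.
move: mon own copy wait copy' wait'.
case: a st => /=; [case|case|case] => {}s;
  try by move=> * /=; split.
- move=> m pcE mon own copy wait copy' wait'; split=> [j|j j'|j m' d] /=;
    rewrite updE; case: eqP => [e|_] //=; rewrite ?e;
    try by [move=> _; apply: own; rewrite ?pcE | apply: own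
           | apply: copy' | apply: wait | apply: wait'].
- move=> m pcE mon own copy wait copy' wait'; split=> [j|j j'|j m' d];
    rewrite /= updE; case: eqP => [e|ne] //=; rewrite ?e;
    try by [move=> _; apply: own; rewrite ?pcE | apply: own
           | apply: copy' | apply: wait | apply: wait'].
  by rewrite /content /= /snapshot_write updE; case: eqP => // _; apply: own.
- move=> m pcE mon own copy wait copy' wait'; split=> [j|j j'|j m' d];
    rewrite /= updE; case: eqP => [e|_] //=; rewrite ?e;
    try by [move=> _; apply: own; rewrite ?pcE | apply: own
           | apply: copy' | apply: wait | apply: wait'].
- move=> m pcE mon own copy wait copy' wait'; split=> [j|j j'|j m' d];
    rewrite /= updE; case: eqP => [e|_] //=; rewrite ?e;
    try by [move=> _; apply: own; rewrite ?pcE | apply: own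
           | apply: copy' | apply: wait | apply: wait'].
  case=> _ <-; apply: fsubset_trans (fsubsetDl _ _) _.
  exact: union_entries_sub.
- move=> m d pcE _ mon own copy wait copy' wait'; split=> [j|j j'|j m' d'];
    rewrite /= updE; case: eqP => [e|_] //=; rewrite ?e;
    try by [move=> _; apply: own; rewrite ?pcE | apply: own
           | apply: copy' | apply: wait | apply: wait'].
Qed.

Definition task_pc_inv s i T : Prop :=
  match tpc T with
  | TkLoop => True
  | TkPropose v => v \in union_entries (MEM s) /\
      (if msg_seq T is ms :: _ then v \in ms else v \notin delivered T)
  | TkDecide r => r = #|` delivered T| /\ proposed (KSET s r) != fset0
  | TkWrite1 r v => r = #|` delivered T| /\ v \in decided (KSET s r)
  | TkSnap1 r => r = #|` delivered T| /\ SNAP1 s r i != None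
  | TkWrite2 r V => r = #|` delivered T| /\
      (V `<=` decided (KSET s r) /\ V != fset0)
  | TkSnap2 r => r = #|` delivered T| /\ SNAP2 s r i != None
  | TkOrder sets => sets != fset0 /\ forall V, V \in sets ->
      V `<=` decided (KSET s #|` delivered T|) /\ V != fset0
  end.

Record obj_inv s : Prop := ObjInv {
  kset_decided : forall r, decided (KSET s r) `<=` proposed (KSET s r);
  kset_bounded : forall r, #|` decided (KSET s r)| <= k;
  kset_proposed : forall r, proposed (KSET s r) `<=` union_entries (MEM s);
  snap1_decided : forall r j v, SNAP1 s r j = Some v ->
    v \in decided (KSET s r);
  snap2_decided : forall r j V, SNAP2 s r j = Some V ->
    V `<=` decided (KSET s r) /\ V != fset0
}.

Record task_inv s i T : Prop := TaskInv {
  inv_pc : task_pc_inv s i T;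
  inv_seq : forall ms, ms \in msg_seq T ->
    ms != fset0 /\ ms `<=` union_entries (MEM s);
  inv_delivered : delivered T `<=` union_entries (MEM s)
}.

Record state_inv s : Prop := Inv {
  inv_op : op_inv s;
  inv_obj : obj_inv s;
  inv_task : forall i, task_inv s i (task s i)
}.

Record shared_le s s' : Prop := SharedLe {
  le_proposed : forall r, proposed (KSET s r) `<=` proposed (KSET s' r);
  le_decided : forall r, decided (KSET s r) `<=` decided (KSET s' r);
  le_snap1 : forall r j, SNAP1 s r j != None -> SNAP1 s' r j != None;
  le_snap2 : forall r j, SNAP2 s r j != None -> SNAP2 s' r j != None;
  le_MEM : union_entries (MEM s) `<=` union_entries (MEM s')
}.

Lemma fset_sub_neq0 (A B : {fset M}) : A `<=` B -> A != fset0 -> B != fset0.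
Proof. by move=> sub; apply: contraNneq => B0; rewrite -fsubset0 -B0. Qed.

Lemma task_inv_le s s' i T : shared_le s s' -> task_inv s i T -> task_inv s' i T.
Proof.
case=> lep led le1 le2 leM [pcI seqI delI]; split; last exact: fsubset_trans leM.
  move: pcI; rewrite /task_pc_inv; case: (tpc T) => //.
  - by move=> v [vM h]; split=> //; apply: (fsubsetP leM).
  - by move=> r [rE h]; split=> //; apply: fset_sub_neq0 h.
  - by move=> r v [rE h]; split=> //; apply: (fsubsetP (led r)).
  - by move=> r [rE h]; split=> //; apply: le1.
  - by move=> r V [rE [h h0]]; do !split=> //; apply: fsubset_trans (led r).
  - by move=> r [rE h]; split=> //; apply: le2.
  - move=> S [S0 h]; split=> // V /h[hV V0]; split=> //.
    exact: fsubset_trans (led _).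
by move=> ms /seqI[? h]; split=> //; apply: fsubset_trans leM.
Qed.

Lemma step_shared i a x s s' : step k i a x s s' -> op_inv s -> shared_le s s'.
Proof.
move=> st opI.
have leM : union_entries (MEM s) `<=` union_entries (MEM s').
  by apply: union_entries_sub => j; apply: step_content st opI.
case: a st leM => /=; [case|case|case] => {opI}s; try by split.
- move=> v r _ _ leM; split=> //= r'; rewrite updE; case: (r' =P r) => // -> //=.
  exact: fsubsetUr.
- move=> r v o _ [_ _ ->] leM; split=> //= r'; rewrite updE;
    case: eqP => // -> //=; exact: fsubsetUr.
- move=> r v _ leM; split=> //= r' j; rewrite updE; case: (r' =P r) => // -> //=.
  by rewrite /snapshot_write updE; case: ifP.
- move=> r v _ leM; split=> //= r' j; rewrite updE; case: (r' =P r) => // -> //=.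
  by rewrite /snapshot_write updE; case: ifP.
Qed.

Lemma step_obj_inv i a x s s' : step k i a x s s' -> state_inv s -> obj_inv s'.
Proof.
move=> st [opI [dec bnd pro sn1 sn2] tkI].
have [_ _ _ _ leM] := step_shared st opI.
have pro' r : proposed (KSET s r) `<=` union_entries (MEM s').
  exact: fsubset_trans (pro r) leM.
case: a st {opI} dec bnd pro sn1 sn2 tkI leM pro' => /=;
  [case|case|case] => {}s; try by move=> * /=; split.
- move=> v r pcE rE dec bnd pro sn1 sn2 tkI leM pro'.
  have := inv_pc (tkI i); rewrite /task_pc_inv pcE => -[vM _].
  split=> //= [r'|r'|r'|r' j w|r' j V]; rewrite updE;
    case: eqP => [e|_] //=; rewrite ?e;
    try exact: sn1; try exact: sn2.
  + exact: fsubset_trans (dec r) (fsubsetUr _ _).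
  + by rewrite fsubUset fsub1set vM pro.
- move=> r v o pcE [vp vk ->] dec bnd pro sn1 sn2 tkI leM pro'.
  split=> //= [r'|r'|r'|r' j w|r' j V]; rewrite updE;
    case: eqP => [e|_] //=; rewrite ?e;
    try exact: sn1; try exact: sn2.
  + by rewrite fsubUset fsub1set vp dec.
  + by move=> /sn1 h; rewrite !inE h orbT.
  + by move=> /sn2[h V0]; split=> //; apply: fsubset_trans h (fsubsetUr _ _).
- move=> r v pcE dec bnd pro sn1 sn2 tkI leM pro'; split=> //= r' j w.
  rewrite updE; case: eqP => [e|_] //=; rewrite ?e; last exact: sn1.
  rewrite /snapshot_write updE; case: eqP => [_ [<-]|_]; last exact: sn1.
  by have := inv_pc (tkI i); rewrite /task_pc_inv pcE => -[].
- move=> r v pcE dec bnd pro sn1 sn2 tkI leM pro'; split=> //= r' j w.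
  rewrite updE; case: eqP => [e|_] //=; rewrite ?e; last exact: sn2.
  rewrite /snapshot_write updE; case: eqP => [_ [<-]|_]; last exact: sn2.
  by have := inv_pc (tkI i); rewrite /task_pc_inv pcE => -[].
Qed.

Lemma merge_seqP (new_sq sq : seq {fset M}) first rest :
  merge_seq new_sq sq = first :: rest ->
  forall ms, ms \in first :: rest ->
    ms \in new_sq \/ exists2 ms', ms' \in sq & ms != fset0 /\
       ms = ms' `\` \bigcup_(s <- new_sq) s.
Proof.
move=> <- ms; rewrite mem_cat => /orP[->|]; first by left.
by rewrite mem_filter => /andP[ms0 /mapP[ms' h E]]; right; exists ms'.
Qed.

Lemma step_task_inv i a x s s' j : step k i a x s s' -> state_inv s ->
  task_inv s' j (task s' j).
Proof.
move=> st I; have le := step_shared st (inv_op I).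
have O' := step_obj_inv st I.
have := task_inv_le le (inv_task I j).
case: I => opI objI tkI.
case: a st {opI} objI tkI le O' => /=; [case|case|case] => {}s; try by [].
- move=> v pcE qE vM objI tkI le O' [pcI seqI delI]; rewrite /= updE; case: eqP => // e.
  rewrite -e in vM pcE qE *; split=> //=; move: vM; rewrite inE => /andP[vD vM].
  by rewrite /task_pc_inv /= qE.
- move=> ms q v pcE qE vms objI tkI le O' [pcI seqI delI]; rewrite /= updE;
    case: eqP => // e; rewrite -e in pcE qE *; split=> //=.
  rewrite /task_pc_inv /= qE; split=> //.
  have [_ sub] : ms != fset0 /\ ms `<=` union_entries (MEM s).
    by apply: seqI; rewrite qE mem_head.
  exact: (fsubsetP sub).
- move=> v r pcE rE objI tkI le O' [pcI seqI delI]; rewrite /= updE;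
    case: eqP => // e; rewrite -e in pcE rE *; split=> //=.
  split=> //=; rewrite updE eqxx /=.
  by apply/fset0Pn; exists v; rewrite !inE eqxx.
- move=> r v o pcE oE objI tkI le O' [pcI seqI delI]; rewrite /= updE;
    case: eqP => // e; rewrite -e in pcE *; split=> //=.
  have := inv_pc (tkI j); rewrite /task_pc_inv pcE /= => -[-> _]; split=> //.
  by rewrite updE eqxx; case: oE => _ _ ->; rewrite !inE eqxx.
- move=> r v pcE objI tkI le O' [pcI seqI delI]; rewrite /= updE;
    case: eqP => // e; rewrite -e in pcE *; split=> //=.
  have := inv_pc (tkI j); rewrite /task_pc_inv pcE /= => -[-> _]; split=> //.
  by rewrite updE eqxx /snapshot_write updE eqxx.
- move=> r pcE objI tkI le O' [pcI seqI delI]; rewrite /= updE;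
    case: eqP => // e; rewrite -e in pcE *; split=> //=.
  have := inv_pc (tkI j); rewrite /task_pc_inv pcE /= => -[-> w]; split=> //.
  split; first by apply/fsubsetP => v /in_entries[j' /(snap1_decided objI)].
  case E: (SNAP1 _ _ j) w => [v|] // _.
  by apply/fset0Pn; exists v; apply/in_entries; exists j.
- move=> r V pcE objI tkI le O' [pcI seqI delI]; rewrite /= updE;
    case: eqP => // e; rewrite -e in pcE *; split=> //=.
  have := inv_pc (tkI j); rewrite /task_pc_inv pcE /= => -[-> _]; split=> //.
  by rewrite updE eqxx /snapshot_write updE eqxx.
- move=> r pcE objI tkI le O' [pcI seqI delI]; rewrite /= updE;
    case: eqP => // e; rewrite -e in pcE *; split=> //=.
  have := inv_pc (tkI j); rewrite /task_pc_inv pcE /= => -[-> w]; split.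
    case E: (SNAP2 _ _ j) w => [V|] // _.
    by apply/fset0Pn; exists V; apply/in_entries; exists j.
  by move=> V /in_entries[j' /(snap2_decided objI)].
- move=> S nsq first rest pcE sq mE objI tkI le O' [pcI seqI delI]; rewrite /= updE;
    case: eqP => // e; rewrite -e in pcE mE *.
  have sub ms : ms \in first :: rest ->
      ms != fset0 /\ ms `<=` union_entries (MEM s).
    move=> /(merge_seqP mE)[/(split_sets_sub sq)|].
      move=> [ms0 [V VS msV]]; split=> //.
      have := inv_pc (tkI j); rewrite /task_pc_inv pcE /= => -[_ /(_ _ VS)[VD _]].
      apply: fsubset_trans msV _; apply: fsubset_trans VD _.
      exact: fsubset_trans (kset_decided objI _) (kset_proposed objI _).
    move=> [ms' /seqI[_ h] [ms0 E]]; split=> //; rewrite E.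
    exact: fsubset_trans (fsubsetDl _ _) h.
  split=> //= [ms msr|]; first by apply: sub; rewrite inE msr orbT.
  by rewrite fsubUset delI; have [] := sub first (mem_head _ _).
Qed.

Lemma inv_init : state_inv init_state.
Proof.
split; first by split=> //= i j; rewrite ?fsub0set // updE; case: ifP.
  split=> //=.
by move=> i; split=> //=; rewrite fsub0set.
Qed.

Lemma step_inv i a x s s' : step k i a x s s' -> state_inv s -> state_inv s'.
Proof.
move=> st I; split; first exact: step_op_inv st (inv_op I).
  exact: step_obj_inv st I.
by move=> j; apply: step_task_inv st I.
Qed.

Lemma step_proposed i a x s s' r v : step k i a x s s' ->
  v \in proposed (KSET s' r) ->
  v \in proposed (KSET s r) \/
  tpc (task s i) = TkPropose v /\ r = #|` delivered (task s i)|.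
Proof.
case: a => /=; [case|case|case] => {}s; try by move=> *; left.
- move=> w r' pcE rE; rewrite /= updE; case: (r =P r') => [->|_]; last by left.
  by rewrite !inE => /orP[/eqP->|]; [right | left].
- move=> r' w o _ [_ _ ->]; rewrite /= updE.
  by case: (r =P r') => [->|_] /=; left.
Qed.

Lemma step_snap1 i a x s s' r j : step k i a x s s' ->
  SNAP1 s' r j = SNAP1 s r j \/
  (exists v, tpc (task s j) = TkWrite1 r v) /\ tpc (task s' j) = TkSnap1 M r.
Proof.
case: a => /=; [case|case|case] => {}s; try by move=> *; left.
move=> r' v pcE; rewrite /= updE; case: (r =P r') => [->|_]; last by left.
rewrite /snapshot_write !updE; case: (j =P i) => [->|_]; last by left.
by right; split=> //; exists v.
Qed.

Lemma step_snap2 i a x s s' r j : step k i a x s s' ->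
  SNAP2 s' r j = SNAP2 s r j \/
  exists V, [/\ tpc (task s j) = TkWrite2 r V, SNAP2 s' r j = Some V &
    tpc (task s' j) = TkSnap2 M r].
Proof.
case: a => /=; [case|case|case] => {}s; try by move=> *; left.
move=> r' V pcE; rewrite /= updE; case: (r =P r') => [->|_]; last by left.
rewrite /snapshot_write !updE; case: (j =P i) => [->|_]; last by left.
by right; exists V; split.
Qed.

Lemma step_write2 i a x s s' r j V : step k i a x s s' ->
  tpc (task s' j) = TkWrite2 r V ->
  tpc (task s j) = TkWrite2 r V \/ V = entries (SNAP1 s r).
Proof.
case: a => /=; [case|case|case] => {}s; try by move=> *; left.
1-9: move=> *; match goal with H : tpc (task _ _) = _ |- _ => move: H end;
  rewrite /= updE; case: ifP => _; try (by left); try by [].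
by move=> [<- <-]; right.
Qed.

Lemma step_order i a x s s' j S : step k i a x s s' ->
  tpc (task s' j) = TkOrder S ->
  delivered (task s' j) = delivered (task s j) /\
  (tpc (task s j) = TkOrder S \/
   exists2 r, tpc (task s j) = TkSnap2 M r & S = entries (SNAP2 s r)).
Proof.
case: a => /=; [case|case|case] => {}s; try by move=> *; split; [|left].
1-9: move=> *; match goal with H : tpc (task _ _) = _ |- _ => move: H end;
  rewrite /= updE; case: (j =P i) => [->|_] /=;
  try (by split; [|left]); try by [].
by move=> [<-]; split=> //; right; eexists; first by eauto.
Qed.

Lemma step_oneshot i a j r o s s' : step k i a (OneShotOp M j r o) s s' ->
  state_inv s ->
  [/\ phase (tpc (task s j)) = op_phase o,
      phase (tpc (task s' j)) = (op_phase o).+1 &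
      r = #|` delivered (task s j)|] /\
  [/\ o = Snap1Snapshot -> tpc (task s j) = TkSnap1 M r,
      o = Snap2Snapshot -> tpc (task s j) = TkSnap2 M r &
      delivered (task s' j) = delivered (task s j)].
Proof.
move: {1 3}(OneShotOp M j r o) (erefl (OneShotOp M j r o)) => x xE.
move=> H /inv_task/(_ j)/inv_pc; rewrite /task_pc_inv; move: xE.
case: a H => /=; [case|case|case] => {}s //.
- move=> v r' pcE -> [<- <- <-]; rewrite /= updE eqxx pcE /=.
  by split; split.
- by move=> r' v pcE [<- <- <-]; rewrite /= updE eqxx pcE /= => -[-> _].
- by move=> r' pcE [<- <- <-]; rewrite /= updE eqxx pcE /= => -[-> _].
- by move=> r' v pcE [<- <- <-]; rewrite /= updE eqxx pcE /= => -[-> _].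
- by move=> r' pcE [<- <- <-]; rewrite /= updE eqxx pcE /= => -[-> _].
Qed.

Lemma step_after_write1 i a x s s' r j : step k i a x s s' ->
  tpc (task s' j) = TkSnap1 M r ->
  tpc (task s j) = TkSnap1 M r \/ x = OneShotOp M j r Snap1Write.
Proof.
case: a => /=; [case|case|case] => {}s; try by move=> *; left.
1-9: move=> *; match goal with H : tpc (task _ _) = _ |- _ => move: H end;
  rewrite /= updE; case: (j =P i) => [->|_]; try (by left); try by [].
by move=> [<-]; right.
Qed.

Lemma step_after_write2 i a x s s' r j : step k i a x s s' ->
  tpc (task s' j) = TkSnap2 M r ->
  tpc (task s j) = TkSnap2 M r \/ x = OneShotOp M j r Snap2Write.
Proof.
case: a => /=; [case|case|case] => {}s; try by move=> *; left.
1-9: move=> *; match goal with H : tpc (task _ _) = _ |- _ => move: H end;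
  rewrite /= updE; case: (j =P i) => [->|_]; try (by left); try by [].
by move=> [<-]; right.
Qed.

Lemma step_MEM i a x s s' m : step k i a x s s' -> op_inv s ->
  m \in union_entries (MEM s') ->
  m \in union_entries (MEM s) \/ opc (op s i) = OpWrite m.
Proof.
case: a => /=; [case|case|case] => {}s; try by move=> *; left.
move=> w pcE opI /in_union_entries[j]; rewrite /= /snapshot_write updE.
case: ifP => _; last by left; apply/in_union_entries; exists j.
rewrite /= inE => /orP[h|]; last by rewrite inE => /eqP->; right.
left; apply/in_union_entries; exists i.
exact: (fsubsetP (op_copy opI i i)).
Qed.

Lemma step_after_invoke i a x s s' j m : step k i a x s s' ->
  opc (op s' j) = OpWrite m ->
  opc (op s j) = OpWrite m \/ x = Interface (Broadcast j m).
Proof.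
case: a => /=; [case|case|case] => {}s; try by move=> *; left.
1-5: move=> *; match goal with H : opc (op _ _) = _ |- _ => move: H end;
  rewrite /= updE; case: (j =P i) => [->|_]; try (by left); try by [].
by move=> [<-]; right.
Qed.

End Steps.

(** * Agreement between the instances *)

Section Run.
Variables (n k : nat) (M : choiceType) (e : execution n M).
Hypothesis run_e : is_run k e.
Implicit Types (i j : 'I_n) (t r : nat) (m : M) (V first : {fset M}).

Notation tk t i := (task (st e t) i).
Notation Dl i t := (delivered (task (st e t) i)).
Notation Sq i t := (msg_seq (task (st e t) i)).

Lemma state_inv_at t : state_inv k (st e t).
Proof.
elim: t => [|t IH]; first by rewrite (run_init run_e); apply: inv_init.
exact: step_inv (run_step run_e t) IH.
Qed.

Definition delivers j t first := delivery j (act e t) (st e t) (st e t.+1) first.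

Lemma task_at t j : (exists first, delivers j t first) \/
  [/\ forall ms, act e t <> Interface (Deliver j ms), Dl j t.+1 = Dl j t,
      Sq j t.+1 = Sq j t & phase (tpc (tk t j)) <= phase (tpc (tk t.+1 j))].
Proof. exact: step_task (run_step run_e t). Qed.

Lemma act_delivers t j ms : act e t = Interface (Deliver j ms) ->
  delivers j t ms.
Proof.
move=> E; case: (task_at t j) => [[first d]|[/(_ ms)//]].
by case: (d) => S [q [rest [E' *]]]; move: E'; rewrite E => -[->].
Qed.

Lemma delivers_delivered j t first : delivers j t first ->
  Dl j t.+1 = Dl j t `|` first.
Proof. by move=> [S [q [rest [_ _ _ _ ->]]]]. Qed.

Lemma delivered_mono j t t' : t <= t' -> Dl j t `<=` Dl j t'.
Proof.
elim: t' => [|t' IH]; first by rewrite leqn0 => /eqP->.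
rewrite leq_eqVlt => /orP[/eqP->//|/IH]; move/fsubset_trans; apply.
case: (task_at t' j) => [[first /delivers_delivered->]|[_ -> _ _]] //.
exact: fsubsetUl.
Qed.

Lemma card_delivered_mono j t t' : t <= t' -> #|` Dl j t| <= #|` Dl j t'|.
Proof. by move=> le; apply/fsubset_leq_card/delivered_mono. Qed.

Lemma proposed_by t r v : v \in proposed (KSET (st e t) r) ->
  exists j t', [/\ t' < t, tpc (tk t' j) = TkPropose v & r = #|` Dl j t'|].
Proof.
elim: t => [|t IH]; first by rewrite (run_init run_e).
move=> /(step_proposed (run_step run_e t))[/IH|[pcE rE]].
  by move=> [j [t' [lt ? ?]]]; exists j, t'; split=> //; apply: leqW.
by exists (actor e t), t.
Qed.

Definition is_view r V := exists t, V = entries (SNAP1 (st e t) r).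
Definition is_sets r S := exists t, S = entries (SNAP2 (st e t) r).

Lemma write2_view t j r V : tpc (tk t j) = TkWrite2 r V -> is_view r V.
Proof.
elim: t => [|t IH]; first by rewrite (run_init run_e).
move=> /(step_write2 (run_step run_e t))[/IH//|->]; by exists t.
Qed.

Lemma snap2_view t j r V : SNAP2 (st e t) r j = Some V -> is_view r V.
Proof.
elim: t => [|t IH]; first by rewrite (run_init run_e).
have [->//|[V' [w -> _] [<-]]] := step_snap2 r j (run_step run_e t).
exact: write2_view w.
Qed.

Lemma order_sets t j S : tpc (tk t j) = TkOrder S -> is_sets #|` Dl j t| S.
Proof.
elim: t => [|t IH]; first by rewrite (run_init run_e).
move=> /(step_order (run_step run_e t))[-> [/IH//|[r w ->]]].
by have := inv_pc (inv_task (state_inv_at t) j);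
  rewrite /task_pc_inv w => -[<- _]; exists t.
Qed.

Lemma deliversP j t first : delivers j t first -> exists S q rest,
  [/\ is_sets #|` Dl j t| S, first \in S,
      forall V, V \in S -> #|` first| <= #|` V| &
      [/\ split_sets S (first :: q), split_sets [fset s `\` first | s in S] q,
      merge_seq (first :: q) (Sq j t) = first :: rest & Sq j t.+1 = rest]] /\
  forall V, V \in S -> [/\ V != fset0, #|` V| <= k, is_view #|` Dl j t| V &
   forall v, v \in V -> exists j' t',
    [/\ t' < t, tpc (tk t' j') = TkPropose v & #|` Dl j' t'| = #|` Dl j t|]].
Proof.
move=> [S [q [rest [_ pcE sq mE tE]]]].
have I := state_inv_at t.
have := inv_pc (inv_task I j).
rewrite /task_pc_inv pcE => -[S0 SI].
have [||first' [q' [qE firstS minS sq']]] := split_sets_head sq => //.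
  by move=> V /SI[].
have fE : first' = first by move: mE; rewrite qE /merge_seq /= => -[].
subst first'; rewrite {}qE in sq mE; have sets := order_sets pcE.
exists S, q', rest; split; first by do !split=> //; rewrite tE.
move=> V VS; have [VD V0] := SI _ VS; split=> //.
- exact: leq_trans (fsubset_leq_card VD) (kset_bounded (inv_obj I) _).
- by case: sets VS => t' -> /in_entries[j' /snap2_view].
- move=> v vV; have /proposed_by[j' [t' [? ? ?]]] :
    v \in proposed (KSET (st e t) #|` Dl j t|).
    apply: (fsubsetP (kset_decided (inv_obj I) _)).
    exact: (fsubsetP VD).
  by exists j', t'.
Qed.

Definition grows r := forall j t first, delivers j t first ->
  #|` Dl j t| = r -> r < #|` Dl j t.+1|.

(* Encodes the lexicographic order, as phases are less than 8. *)
Definition progress j t := #|` Dl j t| * 8 + phase (tpc (tk t j)).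

Lemma progress_mono r c j t t' : grows r -> c < 8 -> t <= t' ->
  r * 8 + c <= progress j t -> r * 8 + c <= progress j t'.
Proof.
move=> gr c8; elim: t' => [|t' IH]; first by rewrite leqn0 => /eqP->.
rewrite leq_eqVlt => /orP[/eqP->//|/IH h /h{h}]; rewrite /progress.
have ph8 : phase (tpc (tk t' j)) < 8 by case: (tpc _).
case: (task_at t' j) => [[first d]|[_ -> _]]; last by lia.
have := gr _ _ _ d; have := card_delivered_mono j (leqnSn t').
move: #|` _| #|` _| => a b ab h; have [br|] := eqVneq b r; last by lia.
by have := h br; lia.
Qed.

Lemma phase_progress t j r c : phase (tpc (tk t j)) = c ->
  r = #|` Dl j t| -> progress j t = r * 8 + c.
Proof. by rewrite /progress => -> ->. Qed.

Lemma snap1_progress r j t : grows r -> SNAP1 (st e t) r j != None ->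
  r * 8 + 4 <= progress j t.
Proof.
move=> gr; elim: t => [|t IH]; first by rewrite (run_init run_e).
case: (step_snap1 r j (run_step run_e t)) => [->/IH|[_ pcE] _].
  exact: progress_mono.
have := inv_pc (inv_task (state_inv_at t.+1) j).
by rewrite /task_pc_inv /progress pcE => -[<- _].
Qed.

Lemma snap2_progress r j t : grows r -> SNAP2 (st e t) r j != None ->
  r * 8 + 6 <= progress j t.
Proof.
move=> gr; elim: t => [|t IH]; first by rewrite (run_init run_e).
case: (step_snap2 r j (run_step run_e t)) => [->/IH|[V [_ _ pcE]] _].
  exact: progress_mono.
have := inv_pc (inv_task (state_inv_at t.+1) j).
by rewrite /task_pc_inv /progress pcE => -[<- _].
Qed.

Lemma snap1_stable r j t t' v : grows r -> t <= t' ->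
  SNAP1 (st e t) r j = Some v -> SNAP1 (st e t') r j = Some v.
Proof.
move=> gr; elim: t' => [|t' IH]; first by rewrite leqn0 => /eqP->.
rewrite leq_eqVlt => /orP[/eqP->//|/IH h /h{h}E].
case: (step_snap1 r j (run_step run_e t')) => [->//|[[w pcE] _]].
have := @snap1_progress r j t' gr; rewrite E => /(_ isT).
have := inv_pc (inv_task (state_inv_at t') j).
by rewrite /task_pc_inv /progress pcE => -[<- _] /=; lia.
Qed.

Lemma snap2_stable r j t t' V : grows r -> t <= t' ->
  SNAP2 (st e t) r j = Some V -> SNAP2 (st e t') r j = Some V.
Proof.
move=> gr; elim: t' => [|t' IH]; first by rewrite leqn0 => /eqP->.
rewrite leq_eqVlt => /orP[/eqP->//|/IH h /h{h}E].
case: (step_snap2 r j (run_step run_e t')) => [->//|[w [pcE _ _]]].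
have := @snap2_progress r j t' gr; rewrite E => /(_ isT).
have := inv_pc (inv_task (state_inv_at t') j).
by rewrite /task_pc_inv /progress pcE => -[<- _] /=; lia.
Qed.

Lemma views_chain r V V' : grows r -> is_view r V -> is_view r V' ->
  V `<=` V' \/ V' `<=` V.
Proof.
move=> gr [t ->] [t' ->]; case: (leqP t t') => [|/ltnW] le; [left|right];
  by apply/fsubsetP => v /in_entries[j /(snap1_stable gr le) h];
  apply/in_entries; exists j.
Qed.

Lemma sets_chain r S S' : grows r -> is_sets r S -> is_sets r S' ->
  S `<=` S' \/ S' `<=` S.
Proof.
move=> gr [t ->] [t' ->]; case: (leqP t t') => [|/ltnW] le; [left|right];
  by apply/fsubsetP => v /in_entries[j /(snap2_stable gr le) h];
  apply/in_entries; exists j.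
Qed.

Definition agreement r := forall i j t t',
  #|` Dl i t| = r -> #|` Dl j t'| = r -> Dl i t = Dl j t'.

Definition consistent r i t :=
  (forall s x, s \in Sq i t -> x \in s -> x \notin Dl i t) /\
  (forall j t', #|` Dl j t'| < r <= #|` Dl j t'.+1| ->
    Dl j t'.+1 \in cuts (Dl i t) (Sq i t)).

Lemma proposed_fresh r i t v : consistent r i t -> #|` Dl i t| = r ->
  tpc (tk t i) = TkPropose v ->
  v \notin Dl i t /\ forall j t', #|` Dl j t'| < r < #|` Dl j t'.+1| ->
    v \in Dl j t'.+1.
Proof.
move=> [dis jmp] rE pcE; have := inv_pc (inv_task (state_inv_at t) i).
rewrite /task_pc_inv pcE => -[_]; case E: (Sq i t) => [|ms q] vms; split=> //.
- move=> j t' lt; have /jmp : #|` Dl j t'| < r <= #|` Dl j t'.+1| by lia.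
  rewrite E in_cuts_nil => /eqP E'; rewrite E' rE in lt; lia.
- by apply: dis vms; rewrite E mem_head.
- move=> j t' lt; have /jmp : #|` Dl j t'| < r <= #|` Dl j t'.+1| by lia.
  rewrite E => /cuts_first/(_ _)/fsubsetP sub; apply: sub.
    by apply/eqP => E'; rewrite E' rE in lt; lia.
  by rewrite inE vms orbT.
Qed.

Definition instance_ok r := agreement r /\
  forall i t, #|` Dl i t| = r -> consistent r i t.

Lemma fresh_value r i t x : agreement r ->
  (forall j t', t' < t -> #|` Dl j t'| = r -> consistent r j t') ->
  #|` Dl i t| = r ->
  (exists j t', [/\ t' < t, tpc (tk t' j) = TkPropose x
     & #|` Dl j t'| = #|` Dl i t|]) ->
  x \notin Dl i t /\ forall j t', #|` Dl j t'| < r < #|` Dl j t'.+1| ->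
    x \in Dl j t'.+1.
Proof.
move=> agr cons rE [j [t' [lt pcE rE']]]; rewrite rE in rE'.
rewrite (agr _ _ _ _ rE rE').
exact: proposed_fresh (cons _ _ lt rE') rE' pcE.
Qed.

Lemma fresh_grows r i t first : agreement r ->
  (forall j t', t' < t -> #|` Dl j t'| = r -> consistent r j t') ->
  delivers i t first -> #|` Dl i t| = r -> r < #|` Dl i t.+1|.
Proof.
move=> agr cons d rE; have [S [q [rest [[_ fS _ _] SI]]]] := deliversP d.
have [/fset0Pn[x xf] _ _ /(_ _ xf) pr] := SI _ fS.
have [xD _] := fresh_value agr cons rE pr.
rewrite -rE (delivers_delivered d); apply: fproper_ltn_card.
rewrite fproperE fsubsetUl; apply/fsubsetPn; exists x => //.
by rewrite inE xf orbT.
Qed.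

Lemma delivers_of_size i t : #|` Dl i t| < #|` Dl i t.+1| ->
  exists first, delivers i t first.
Proof. by case: (task_at t i) => // -[_ -> _ _]; rewrite ltnn. Qed.

Lemma instance_grows r : instance_ok r -> grows r.
Proof. by move=> [agr cons] i t first; apply: fresh_grows => // *; apply: cons. Qed.

Lemma instance_chain r i t S : instance_ok r -> #|` Dl i t| = r ->
  (forall V, V \in S -> [/\ V != fset0, #|` V| <= k, is_view #|` Dl i t| V &
   forall v, v \in V -> exists j' t',
    [/\ t' < t, tpc (tk t' j') = TkPropose v & #|` Dl j' t'| = #|` Dl i t|]]) ->
  chain S.
Proof.
move=> ok rE SI V V' /SI[_ _ w _] /SI[_ _ w' _].
by apply: views_chain w w'; rewrite rE; apply: instance_grows.
Qed.

Lemma arrival_consistent r i t : (forall q, q < r -> instance_ok q) ->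
  #|` Dl i t| < r -> #|` Dl i t.+1| = r -> consistent r i t.+1.
Proof.
move=> ok lt rE; have [first d] : exists first, delivers i t first.
  by apply: delivers_of_size; rewrite rE.
have [S [q [rest [[sets fS minS [sq sq' mE qE]] SI]]]] := deliversP d.
set q0 := #|` Dl i t| in lt; have ok0 := ok _ lt.
have [agr0 cons0] := ok0; have [dis0 jmp0] := cons0 i t erefl.
have cS := instance_chain ok0 erefl SI.
have fresh V x : V \in S -> x \in V -> x \notin Dl i t /\
    forall j t', #|` Dl j t'| < q0 < #|` Dl j t'.+1| -> x \in Dl j t'.+1.
  move=> /SI[_ _ _ h] /h; apply: fresh_value => // *; exact: cons0.
have DE := delivers_delivered d.
split.
  rewrite qE DE; apply: merge_disjoint sq' _ dis0 _ mE.
  by move=> V x VS /(fresh _ _ VS)[].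
move=> j t' /andP[lt1 le1]; set D' := Dl j t'.+1 in le1 *.
suff : D' \in cuts (Dl i t) (first :: rest).
  rewrite in_cuts_cons DE qE => /orP[/eqP E|//].
  by move: le1 lt; rewrite /q0 -E; lia.
have [first' d'] : exists first, delivers j t' first.
  by apply: delivers_of_size; apply: leq_trans lt1 le1.
have DE' := delivers_delivered d'.
have [S' [q' [rest' [[sets' fS' minS' _] SI']]]] := deliversP d'.
have ok1 := ok _ lt1.
have cS' := instance_chain ok1 erefl SI'.
have [lt01|lt10|eq01] := ltngtP q0 #|` Dl j t'|.
(* [i] jumped over the instance in which [j] delivered. *)
- have [agr1 cons1] := ok1.
  have [_ /(_ i t)] := cons1 j t' erefl; rewrite -/q0 lt01 rE => /(_ (ltnW lt1)) X.
  have sub : D' `<=` Dl i t.+1.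
    rewrite /D' DE' fsubUset (cuts_sup X) /=; apply/fsubsetP => x xf.
    have [_ _ _ /(_ _ xf) pr] := SI' _ fS'.
    have [_ ->//] := @fresh_value _ _ _ _ agr1 (fun _ _ _ => cons1 _ _) erefl pr.
    by rewrite -/q0 lt01 rE.
  have -> : D' = Dl i t.+1 by apply/eqP; rewrite eqEfcard sub rE.
  by rewrite in_cuts_cons DE cuts_head orbT.
(* [j] jumped over the instance in which [i] delivered. *)
- rewrite -mE; apply: (merge_cuts_old sq).
    by apply: jmp0; rewrite -/q0 lt10; apply: ltnW (leq_trans lt le1).
  move=> V VS; apply/fsubsetP => x xV; have [_ ->//] := fresh _ _ VS xV.
  by rewrite lt10; apply: leq_trans lt le1.
- have DD : Dl j t' = Dl i t by apply: agr0.
  rewrite /D' DE' DD -mE; apply: (merge_cuts_view _ _ sq) => //.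
  rewrite -/q0 eq01 in sets.
  have [sub|/fsubsetP sub] := sets_chain (instance_grows ok1) sets sets'; last first.
    exact: sub.
  have fS1 : first \in S' by apply: (fsubsetP sub).
  have sub1 : first' `<=` first.
    apply: (chain_min cS' fS') => //; last by have [] := SI _ fS.
    by move=> V VS' _; apply: minS'.
  have /eqP UE : Dl i t `|` first' == Dl i t `|` first.
    by rewrite eqEfcard fsetUS //= -DE -DD -DE' rE.
  suff -> : first' = first by [].
  apply/eqP; rewrite eqEfsubset sub1; apply/fsubsetP => x xf.
  have [xD _] := fresh _ _ fS xf.
  have : x \in Dl i t `|` first' by rewrite UE inE xf orbT.
  by rewrite inE (negbTE xD).
Qed.

Lemma delivered0 i : Dl i 0 = fset0.
Proof. by rewrite (run_init run_e). Qed.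

Lemma delivered_arrival i t : 0 < #|` Dl i t| -> exists t',
  [/\ t' < t, #|` Dl i t'| < #|` Dl i t| & Dl i t'.+1 = Dl i t].
Proof.
elim: t => [|t IH]; first by rewrite (run_init run_e) cardfs0.
have := card_delivered_mono i (leqnSn t).
rewrite leq_eqVlt => /orP[/eqP E|lt _]; last by exists t.
have <- : Dl i t = Dl i t.+1.
  by apply/eqP; rewrite eqEfcard delivered_mono //= E.
by move=> /IH[t' [lt ? ?]]; exists t'; split=> //; apply: leqW.
Qed.

Lemma all_instances_ok r : instance_ok r.
Proof.
elim/ltn_ind: r => r ok.
have agr : agreement r.
  move=> i j t t' rE rE'; have [r0|r0] := posnP r.
    by apply/eqP; move: rE rE'; rewrite r0 => /cardfs0_eq-> /cardfs0_eq->.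
  have [|ti [_ lti Ei]] := @delivered_arrival i t; first by rewrite rE.
  have [|tj [_ ltj Ej]] := @delivered_arrival j t'; first by rewrite rE'.
  have [_ /(_ j tj)] : consistent r i ti.+1.
    by apply: arrival_consistent => //; rewrite -?rE // Ei.
  rewrite Ej rE' leqnn andbT -{1}rE' => /(_ ltj)/cuts_sup; rewrite Ei => sub.
  by apply/eqP; rewrite eqEfcard sub rE rE' /=.
split=> //.
suff cons t : forall i, #|` Dl i t| = r -> consistent r i t by move=> i t; apply: cons.
elim/ltn_ind: t => -[|t] IH i rE.
  split; first by move=> s x; rewrite (run_init run_e).
  by move: rE => <-; rewrite delivered0 cardfs0.
case: (task_at t i) => [[first d]|[_ DE SE _]]; last first.
  by rewrite /consistent DE SE; apply: IH => //; rewrite -DE.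
apply: arrival_consistent => //.
have := card_delivered_mono i (leqnSn t); rewrite rE leq_eqVlt => /orP[/eqP E|//].
suff : r < #|` Dl i t.+1| by rewrite rE ltnn.
by apply: fresh_grows d E => // j t' lt; apply: IH; apply: leqW.
Qed.

Lemma delivery_grows i t first : delivers i t first ->
  #|` Dl i t| < #|` Dl i t.+1|.
Proof. by move=> d; apply: instance_grows (all_instances_ok _) _ _ _ d erefl. Qed.

Lemma delivery_fresh i t first x : delivers i t first -> x \in first ->
  x \notin Dl i t.
Proof.
move=> d xf; have [S [q [rest [[_ fS _ _] SI]]]] := deliversP d.
have [_ _ _ /(_ _ xf) pr] := SI _ fS.
have [agr cons] := all_instances_ok #|` Dl i t|.
by have [] := fresh_value agr (fun _ _ _ => cons _ _) erefl pr.
Qed.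

Lemma delivered_chain i t j t' : #|` Dl i t| <= #|` Dl j t'| ->
  Dl i t `<=` Dl j t'.
Proof.
elim: t' => [|t' IH] le.
  move: le; rewrite delivered0 cardfs0 leqn0 cardfs_eq0 => /eqP->.
  exact: fsub0set.
case: (leqP #|` Dl i t| #|` Dl j t'|) => [/IH h|lt].
  exact: fsubset_trans h (delivered_mono _ (leqnSn _)).
have [_ /(_ i t erefl)[_ /(_ j t')]] := all_instances_ok #|` Dl i t|.
by rewrite lt le => /(_ isT)/cuts_sup.
Qed.

Lemma progress_step r c j t t' : t < t' -> progress j t = r * 8 + c ->
  progress j t.+1 = r * 8 + c.+1 -> c.+1 < 8 -> progress j t' != r * 8 + c.
Proof.
move=> lt _ E c8; have : r * 8 + c.+1 <= progress j t'.
  apply: progress_mono lt _ => //; last by rewrite E.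
  exact/instance_grows/all_instances_ok.
by move=> h; apply/eqP => E'; lia.
Qed.

Lemma oneshot_at t j r o : act e t = OneShotOp M j r o ->
  [/\ phase (tpc (tk t j)) = op_phase o,
      phase (tpc (tk t.+1 j)) = (op_phase o).+1 & r = #|` Dl j t|] /\
  [/\ o = Snap1Snapshot -> tpc (tk t j) = TkSnap1 M r,
      o = Snap2Snapshot -> tpc (tk t j) = TkSnap2 M r &
      Dl j t.+1 = Dl j t].
Proof.
move=> E; have h := run_step run_e t; rewrite E in h.
exact: step_oneshot h (state_inv_at t).
Qed.

Lemma runs_one_shot : one_shot_use e.
Proof.
split=> [t t' i r o E E'|t i r E|t i r E].
- wlog lt : t t' E E' / t < t' => [wl|].
    by case: (ltngtP t t') => // lt; [apply: wl | apply/esym/wl].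
  have [[p1 p2 rE] [_ _ DE]] := oneshot_at E.
  have [[p1' _ rE'] _] := oneshot_at E'.
  have rE2 : r = #|` Dl i t.+1| by rewrite DE.
  have := progress_step lt (phase_progress p1 rE) (phase_progress p2 rE2).
  by rewrite (phase_progress p1' rE') eqxx; case: (o) => /(_ isT).
- have [_ [/(_ erefl) pcE _ _]] := oneshot_at E.
  elim: t pcE {E} => [|t IH]; first by rewrite (run_init run_e).
  move=> /(step_after_write1 (run_step run_e t))[/IH[t' [lt ?]]|].
    by exists t'; split=> //; apply: leqW.
  by exists t.
- have [_ [_ /(_ erefl) pcE _]] := oneshot_at E.
  elim: t pcE {E} => [|t IH]; first by rewrite (run_init run_e).
  move=> /(step_after_write2 (run_step run_e t))[/IH[t' [lt ?]]|].
    by exists t'; split=> //; apply: leqW.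
  by exists t.
Qed.
End Run.

(** * Progress *)

Section Progress.
Variables (n k : nat) (M : choiceType).
Implicit Types (s : state n M) (i j : 'I_n) (m : M).

Lemma step_task_frame i a x s s' j : step k i a x s s' ->
  (i = j /\ a = Task) \/ task s' j = task s j.
Proof.
case: a => /=; [by case; right|by case; right|].
case=> {}s *; rewrite /= ?updE; case: (j =P i) => [->|_]; by [left | right].
Qed.

Lemma step_op_frame i a x s s' j : step k i a x s s' ->
  opc (op s j) <> OpIdle ->
  (i = j /\ a = Operation) \/ op s' j = op s j.
Proof.
case: a => /=; [case|case|by case; right] => {}s *;
  rewrite /= ?updE; case: (j =P i) => [E|_]; by [left | right | subst].
Qed.

Lemma step_invoked i a s s' j m : step k i a (Interface (Broadcast j m)) s s' ->
  opc (op s' j) = OpWrite m.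
Proof.
move: {1 3}(Interface _) (erefl (@Interface n M (Broadcast j m))) => x.
case: a => /= E st.
- by case: st E => {}s m' _ [<- <-] /=; rewrite updE eqxx.
- by case: st E.
- by case: st E.
Qed.

Lemma op_step_write i x s s' m : op_step i x s s' -> opc (op s i) = OpWrite m ->
  opc (op s' i) = OpSnapshot m /\ m \in union_entries (MEM s').
Proof.
case=> {}s m' => [->|->|->|d ->] // [->]; rewrite /= updE eqxx; split=> //.
apply/in_union_entries; exists i.
by rewrite /snapshot_write updE eqxx /= !inE eqxx orbT.
Qed.

Lemma op_step_snapshot i x s s' m : op_step i x s s' ->
  opc (op s i) = OpSnapshot m -> opc (op s' i) = OpPending m.
Proof.
by case=> {}s m' => [->|->|->|d ->] // [->]; rewrite /= updE eqxx.
Qed.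

Lemma op_step_pending i x s s' m : op_step i x s s' ->
  opc (op s i) = OpPending m -> exists d, opc (op s' i) = OpWait m d.
Proof.
by case=> {}s m' => [->|->|->|d ->] // [->]; rewrite /= updE eqxx; eexists.
Qed.

Lemma op_step_wait i x s s' m d : op_step i x s s' ->
  opc (op s i) = OpWait m d -> x = Interface (BroadcastReturn i m).
Proof. by case=> {}s m' => [->|->|->|d' ->] // _ [->]. Qed.

Lemma op_enabled i s :
  match opc (op s i) with
  | OpIdle => False
  | OpWait m d => d `<=` delivered (task s i)
  | _ => True
  end -> enabled k i Operation s.
Proof.
case E: (opc _) => [|m|m|m|m d] // sub; eexists; eexists.
- exact: op_write E.
- exact: op_snapshot E.
- exact: op_pending E.
- exact: op_return E sub.
Qed.

Lemma task_enabled i s : 0 < k -> state_inv k s -> enabled k i Task s.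
Proof.
move=> k0 I; have [pcI seqI _] := inv_task I i.
move: pcI; rewrite /task_pc_inv; case E: (tpc _) => [|v|r|r v|r|r V|r|S] pcI.
- case Eq: (msg_seq (task s i)) => [|ms q]; last first.
    have /seqI[/fset0Pn[v vms] _] : ms \in msg_seq (task s i).
      by rewrite Eq mem_head.
    by eexists; eexists; apply: task_from_seq E Eq vms.
  have [D0|/fset0Pn[v vD]] :=
      eqVneq (union_entries (MEM s) `\` delivered (task s i)) fset0.
    by eexists; eexists; apply: task_none E Eq D0.
  by eexists; eexists; apply: task_from_mem E Eq vD.
- by eexists; eexists; apply: task_propose E erefl.
- case: pcI => _ /fset0Pn[v vp].
  have [D0|/fset0Pn[w wD]] := eqVneq (decided (KSET s r)) fset0.
    eexists; eexists; apply: (@task_decide _ _ _ _ _ _ v) E _; split=> //.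
    by rewrite D0 fsetU0 cardfs1.
  eexists; eexists; apply: (@task_decide _ _ _ _ _ _ w) E _; split=> //.
    exact: (fsubsetP (kset_decided (inv_obj I) r)).
  have -> : w |` decided (KSET s r) = decided (KSET s r).
    by apply/fsetUidPr; rewrite fsub1set.
  exact: kset_bounded (inv_obj I) r.
- by eexists; eexists; apply: task_write1 E.
- by eexists; eexists; apply: task_snap1 E.
- by eexists; eexists; apply: task_write2 E.
- by eexists; eexists; apply: task_snap2 E.
- case: pcI => S0 SI; have [q sq] := split_sets_exists S0.
  have [||ms [q' [qE _ _ _]]] := split_sets_head sq => //.
    by move=> V /SI[].
  by eexists; eexists; apply: task_deliver E sq _; rewrite qE.
Qed.

Lemma task_step_progress i x s s' m : task_step k i x s s' ->
  m \in union_entries (MEM s) -> m \notin delivered (task s i) ->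
  (exists first, delivery i x s s' first) \/
  phase (tpc (task s i)) < phase (tpc (task s' i)).
Proof.
case=> {}s.
- move=> _ _ D0 mM mD.
  have : m \in union_entries (MEM s) `\` delivered (task s i) by rewrite inE mD.
  by rewrite D0.
1-8: move=> *; right; rewrite /= updE eqxx /=;
  by match goal with H : tpc _ = _ |- _ => rewrite H end.
move=> S q first rest pcE sq mE _ _; left.
by exists first, S, q, rest; rewrite /= updE eqxx.
Qed.

Definition blocked m (p : op_state n M) : bool :=
  match opc p with
  | OpSnapshot _ => true
  | OpPending _ => m \in union_entries (mem1 p)
  | OpWait _ d => m \in d
  | _ => false
  end.

(* A process takes a snapshot after each write, so once [m] is in MEM its
   kscd_broadcast waits for the delivery of [m]. *)
Lemma step_blocked i a x s s' j m : step k i a x s s' -> op_inv s ->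
  m \in union_entries (MEM s) -> m \notin delivered (task s j) ->
  #|` content s' j| + blocked m (op s j) <=
  #|` content s j| + blocked m (op s' j).
Proof.
case: a => /=; [case|case|by case=> // *] => {}s.
- move=> w pcE opI mM mD; rewrite /= updE; case: eqP => // ->.
  by rewrite /blocked /= pcE.
- move=> w pcE opI mM mD; rewrite /content /= /snapshot_write !updE.
  case: eqP => [->|_] //=; rewrite /blocked /= pcE addn0.
  have -> : odflt fset0 (mem1 (op s i) i) = content s i.
    by apply: op_own opI _ _; rewrite pcE.
  by rewrite cardfsU cardfs1; apply: leq_subr.
- move=> w pcE opI mM mD; rewrite /= updE; case: eqP => // ->.
  by rewrite /blocked /= pcE mM.
- move=> w pcE opI mM mD; rewrite /= updE; case: eqP => // E.
  rewrite -E in pcE *; rewrite /blocked /= pcE inE mD; exact: leqnn.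
- move=> w d pcE sub opI mM mD; rewrite /= updE; case: eqP => // E.
  rewrite -E in pcE sub *; rewrite /blocked /= pcE.
  by rewrite (negbTE (contra (fsubsetP sub m) mD)).
Qed.

Lemma card_union_entries (o : snapshot_object n {fset M}) :
  #|` union_entries o| <= \sum_(j in 'I_n) #|` odflt fset0 (o j)|.
Proof.
rewrite /union_entries; elim/big_ind2: _ => [|A a B b leA leB|//].
  by rewrite cardfs0.
by rewrite cardfsU; lia.
Qed.
End Progress.

Section Specification.
Variables (n k : nat) (M : choiceType) (e : execution n M).
Hypothesis run_e : is_run k e.
Implicit Types (i j : 'I_n) (t r : nat) (m : M).

Notation Dl i t := (delivered (task (st e t) i)).

Lemma history_act t ev : history_of e t = Some ev <-> act e t = Interface ev.
Proof.
by rewrite /history_of; split=> [|->//]; case: (act e t) => // ? [->].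
Qed.

Lemma delivered_event i t m : m \in Dl i t -> exists t' ms,
  [/\ t' < t, act e t' = Interface (Deliver i ms) & m \in ms].
Proof.
elim: t => [|t IH]; first by rewrite (delivered0 run_e).
have old : m \in Dl i t -> exists t' ms,
    [/\ t' < t.+1, act e t' = Interface (Deliver i ms) & m \in ms].
  by move=> /IH[t' [ms [lt ? ?]]]; exists t', ms; split=> //; apply: leqW.
have [[first d]|[_ -> _ _]//] := task_at run_e t i.
rewrite (delivers_delivered d) inE => /orP[/old//|mf].
by case: (d) => S [q [rest [E _ _ _ _]]]; exists t, first.
Qed.

Lemma MEM_broadcast t m : m \in union_entries (MEM (st e t)) ->
  exists t' j, t' < t /\ act e t' = Interface (Broadcast j m).
Proof.
have write t' j : opc (op (st e t') j) = OpWrite m ->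
    exists t'' j', t'' < t' /\ act e t'' = Interface (Broadcast j' m).
  elim: t' => [|t' IH]; first by rewrite (run_init run_e).
  move=> /(step_after_invoke (run_step run_e t'))[/IH|E].
    by move=> [u [j' [lt ?]]]; exists u, j'; split=> //; apply: leqW.
  by exists t', j.
elim: t => [|t IH].
  by rewrite (run_init run_e) => /in_union_entries[j].
move=> /(step_MEM (run_step run_e t) (inv_op (state_inv_at run_e t))).
move=> [/IH|/write] [u [j' [lt ?]]]; exists u, j'; split=> //; exact: leqW.
Qed.

Lemma MEM_mono t t' : t <= t' ->
  union_entries (MEM (st e t)) `<=` union_entries (MEM (st e t')).
Proof.
elim: t' => [|t' IH]; first by rewrite leqn0 => /eqP->.
rewrite leq_eqVlt => /orP[/eqP->//|/IH]; move/fsubset_trans; apply.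
exact: le_MEM (step_shared (run_step run_e t') (inv_op (state_inv_at run_e t'))).
Qed.

Lemma run_safety :
  [/\ kscd_nonempty (history_of e), kscd_validity (history_of e),
      kscd_integrity (history_of e), kscd_ordering (history_of e) &
      kscd_bounded k (history_of e)].
Proof.
split.
- move=> t i ms /history_act/(act_delivers run_e) d.
  have [S [q [rest [[_ fS _ _] SI]]]] := deliversP run_e d.
  by have [] := SI _ fS.
- move=> t i ms m /history_act E mms; have d := act_delivers run_e E.
  have : m \in Dl i t.+1 by rewrite (delivers_delivered d) inE mms orbT.
  move=> /(fsubsetP (inv_delivered (inv_task (state_inv_at run_e t.+1) i))).
  move=> /MEM_broadcast[t' [j [lt E']]]; exists t', j.
  split; last exact/history_act.
  rewrite ltn_neqAle -ltnS lt andbT; apply/eqP => tE.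
  by rewrite tE E in E'.
- move=> t t' i ms ms' m /history_act E mms /history_act E' mms'.
  wlog lt : t t' ms ms' E mms E' mms' / t < t' => [wl|].
    case: (ltngtP t t') => // lt; first exact: (wl _ _ _ _ E mms E').
    by apply/esym; apply: (wl _ _ _ _ E' mms' E).
  have := delivery_fresh run_e (act_delivers run_e E') mms'.
  have d := act_delivers run_e E.
  rewrite (fsubsetP (delivered_mono run_e i lt)) //.
  by rewrite (delivers_delivered d) inE mms orbT.
- have sep i m m' : delivers_before (history_of e) i m m' ->
      exists t, m \in Dl i t /\ m' \notin Dl i t.
    move=> [t [t' [ms [ms' [lt [E mms] [E' mms'] _]]]]]; exists t'.
    move/history_act/(act_delivers run_e): E => d.
    move/history_act/(act_delivers run_e): E' => d'; split.
      apply: (fsubsetP (delivered_mono run_e i lt)).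
      by rewrite (delivers_delivered d) inE mms orbT.
    exact: (delivery_fresh run_e d' mms').
  move=> i m m' /sep[t [mD m'D]] [j /sep[t' [m'D' mD']]].
  have [le|/ltnW le] := leqP #|` Dl i t| #|` Dl j t'|.
    by rewrite (fsubsetP (delivered_chain run_e le)) in mD'.
  by rewrite (fsubsetP (delivered_chain run_e le)) in m'D.
- move=> t i ms /history_act/(act_delivers run_e) d.
  have [S [q [rest [[_ fS _ _] SI]]]] := deliversP run_e d.
  by have [] := SI _ fS.
Qed.

Section Liveness.
Hypothesis k_gt0 : 0 < k.

Lemma eventually_fires i a t (P : state n M -> Prop) :
  nonfaulty e i -> a <> Client -> P (st e t) ->
  (forall t', t <= t' -> P (st e t') -> enabled k i a (st e t')) ->
  (forall t', t <= t' -> P (st e t') ->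
    (actor e t' = i /\ active e t' = a) \/ P (st e t'.+1)) ->
  exists t', [/\ t <= t', P (st e t'), actor e t' = i & active e t' = a].
Proof.
move=> ni na Pt en pres; have [t1 [le fair]] := run_fair run_e ni na t.
have : exists2 t0, t <= t0 <= t1 & P (st e t0) by exists t; rewrite ?leqnn ?le.
move=> [t0 /andP[le0 le1] Pt0].
have [d dE] : exists d, t1 - t0 = d by exists (t1 - t0).
elim: d t0 le0 le1 Pt0 dE => [|d IH] t0 le0 le1 Pt0 dE.
  have E : t1 = t0 by lia.
  rewrite E in fair; case: fair => [[? ?]|[]]; last exact: en.
  by exists t0.
have [[? ?]|Pt0'] := pres _ le0 Pt0; first by exists t0.
apply: (IH t0.+1) => //; lia.
Qed.

Lemma run_step_at t i a : actor e t = i -> active e t = a ->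
  step k i a (act e t) (st e t) (st e t.+1).
Proof. by move=> <- <-; apply: run_step. Qed.

Lemma keeps_delivering i m t : nonfaulty e i ->
  m \in union_entries (MEM (st e t)) -> (forall t', m \notin Dl i t') ->
  forall t1, t <= t1 -> exists2 t2, t1 <= t2 & #|` Dl i t1| < #|` Dl i t2|.
Proof.
move=> ni mM mD t1; have [c cE] : exists c, 8 - phase (tpc (task (st e t1) i)) = c.
  by eexists.
elim/ltn_ind: c t1 cE => c IH t1 cE le1.
have [|t' _ _|t' _ PE|t' [le' PE aE acE]] :=
    @eventually_fires i Task t1 (fun s => task s i = task (st e t1) i) ni _ erefl.
- by [].
- exact: task_enabled k_gt0 (state_inv_at run_e t').
- by rewrite -PE; apply: step_task_frame (run_step run_e t').
have mM' : m \in union_entries (MEM (st e t')).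
  by apply: (fsubsetP (MEM_mono _)) mM; lia.
have := task_step_progress (run_step_at aE acE) mM' (mD t').
have ph8 : phase (tpc (task (st e t'.+1) i)) < 8 by case: (tpc _).
move=> [[first d]|lt].
  by exists t'.+1; [exact: leqW | rewrite -PE; apply: (delivery_grows run_e d)].
rewrite PE in lt.
have [||t2 le2 lt2] := IH (8 - phase (tpc (task (st e t'.+1) i))) _ t'.+1 erefl.
- lia.
- lia.
exists t2; first lia.
apply: leq_ltn_trans lt2; apply: (card_delivered_mono run_e) => //; lia.
Qed.

Lemma delivers_unboundedly i m t N : nonfaulty e i ->
  m \in union_entries (MEM (st e t)) -> (forall t', m \notin Dl i t') ->
  exists2 t', t <= t' & N <= #|` Dl i t'|.
Proof.
move=> ni mM mD; elim: N => [|N [t1 le1 N1]]; first by exists t.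
have [t2 le2 lt2] := keeps_delivering ni mM mD le1.
by exists t2; [exact: leq_trans le2 | exact: leq_ltn_trans lt2].
Qed.

Lemma content_bounded m t0 t j : m \in union_entries (MEM (st e t0)) ->
  (forall t', m \notin Dl j t') -> t0 <= t ->
  #|` content (st e t) j| <= #|` content (st e t0) j| + 1.
Proof.
move=> mM mD le.
suff h : #|` content (st e t) j| + blocked m (op (st e t0) j)
    <= #|` content (st e t0) j| + blocked m (op (st e t) j).
  apply: leq_trans (leq_addr _ _) (leq_trans h _).
  by rewrite leq_add2l leq_b1.
elim: t le => [|t IH]; first by rewrite leqn0 => /eqP->.
rewrite leq_eqVlt => /orP[/eqP->//|le].
have := step_blocked (run_step run_e t) (inv_op (state_inv_at run_e t))
  (fsubsetP (MEM_mono (le : t0 <= t)) _ mM) (mD t).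
by have := IH le; lia.
Qed.

Lemma MEM_eventually_delivered i t m : nonfaulty e i ->
  m \in union_entries (MEM (st e t)) -> exists t', m \in Dl i t'.
Proof.
move=> ni mM; apply: NNPP => no.
have mD t' : m \notin Dl i t' by apply/negP => h; apply: no; exists t'.
have mD' j t' : m \notin Dl j t'.
  apply/negP => h.
  have [u _ leu] := delivers_unboundedly #|` Dl j t'| ni mM mD.
  by move: (mD u); rewrite (fsubsetP (delivered_chain run_e leu)).
pose B := \sum_(j in 'I_n) (#|` content (st e t) j| + 1).
have [u le] := delivers_unboundedly B.+1 ni mM mD.
rewrite ltnNge => /negP; apply.
have sub := inv_delivered (inv_task (state_inv_at run_e u) i).
apply: leq_trans (fsubset_leq_card sub) _.
apply: leq_trans (card_union_entries _) _.
by apply: leq_sum => j _; apply: content_bounded mM (mD' j) le.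
Qed.

Lemma set_eventually_delivered i t (A : {fset M}) : nonfaulty e i ->
  A `<=` union_entries (MEM (st e t)) -> exists2 t', t <= t' & A `<=` Dl i t'.
Proof.
move=> ni; elim/finSet_rect: A => A IH sub.
have [->|/fset0Pn[m mA]] := eqVneq A fset0; first by exists t; rewrite ?fsub0set.
have [t1 le1 sub1] : exists2 t', t <= t' & A `\ m `<=` Dl i t'.
  by apply: IH; [exact: fproperD1 | exact: fsubset_trans (fsubsetDl _ _) sub].
have [t2 m2] := MEM_eventually_delivered ni (fsubsetP sub _ mA).
exists (maxn t1 t2); first exact: leq_trans le1 (leq_maxl _ _).
rewrite -(fsetD1K mA) fsubUset fsub1set.
rewrite (fsubsetP (delivered_mono run_e i (leq_maxr t1 t2)) _ m2).
exact: fsubset_trans sub1 (delivered_mono run_e i (leq_maxl _ _)).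
Qed.

Lemma operation_fires i t p : nonfaulty e i -> op (st e t) i = p ->
  match opc p with OpIdle | OpWait _ _ => False | _ => True end ->
  exists t', [/\ t <= t', op (st e t') i = p &
    op_step i (act e t') (st e t') (st e t'.+1)].
Proof.
move=> ni pE pc.
have [||t' _ PE|t' _ PE|t' [le' PE aE acE]] :=
    @eventually_fires i Operation t (fun s => op s i = p) ni.
- by [].
- by [].
- by apply: op_enabled; rewrite PE; case: (opc p) pc.
- rewrite -[X in _ \/ _ = X]PE; apply: step_op_frame (run_step run_e t') _.
  by rewrite PE => E; rewrite E in pc.
by exists t'; split=> //; apply: (run_step_at aE acE).
Qed.

Lemma wait_returns i t p m d : nonfaulty e i -> op (st e t) i = p ->
  opc p = OpWait m d -> d `<=` union_entries (MEM (st e t)) ->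
  exists2 t', t <= t' & act e t' = Interface (BroadcastReturn i m).
Proof.
move=> ni pE pc sub; have [T leT dT] := set_eventually_delivered ni sub.
have notidle t' : op (st e t') i = p -> opc (op (st e t') i) <> OpIdle.
  by move=> ->; rewrite pc.
have return_at t' : op (st e t') i = p -> actor e t' = i -> active e t' = Operation ->
    act e t' = Interface (BroadcastReturn i m).
  by move=> PE aE acE; apply: (op_step_wait (run_step_at aE acE) (d := d)); rewrite PE.
have pending c : op (st e (t + c)) i = p \/
    exists2 t', t <= t' & act e t' = Interface (BroadcastReturn i m).
  elim: c => [|c [PE|]]; [by left; rewrite addn0| |by right].
  rewrite addnS.
  have [[aE acE]|->] := step_op_frame (run_step run_e (t + c)) (notidle _ PE).
    by right; exists (t + c); [exact: leq_addr | exact: (return_at _ PE)].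
  by left.
have [|//] := pending (T - t); rewrite subnKC // => PT.
have [||t' le' [PE dE]|t' le' [PE dE]|t' [le' [PE dE] aE acE]] :=
    @eventually_fires i Operation T
      (fun s => op s i = p /\ d `<=` delivered (task s i)) ni.
- by [].
- by [].
- by apply: op_enabled; rewrite PE pc.
- have [|->] := step_op_frame (run_step run_e t') (notidle _ PE); first by left.
  right; split=> //; apply: fsubset_trans dE _.
  exact: (delivered_mono run_e i (leqnSn t')).
by exists t'; [exact: leq_trans leT le' | exact: (return_at _ PE)].
Qed.

Lemma run_termination1 : kscd_termination1 (nonfaulty e) (history_of e).
Proof.
move=> t i m ni /history_act E.
have pc1 : opc (op (st e t.+1) i) = OpWrite m.
  have h := run_step run_e t; rewrite E in h.
  exact: step_invoked h.
have [|t1 [le1 E1 w]] := operation_fires ni (erefl (op (st e t.+1) i));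
  first by rewrite pc1.
have [pc2 mM] : opc (op (st e t1.+1) i) = OpSnapshot m /\
    m \in union_entries (MEM (st e t1.+1)).
  by apply: op_step_write w _; rewrite E1.
have [|t2 [le2 E2 sn]] := operation_fires ni (erefl (op (st e t1.+1) i));
  first by rewrite pc2.
have pc3 : opc (op (st e t2.+1) i) = OpPending m.
  by apply: op_step_snapshot sn _; rewrite E2.
have [|t3 [le3 E3 pn]] := operation_fires ni (erefl (op (st e t2.+1) i));
  first by rewrite pc3.
have [d pc4] : exists d, opc (op (st e t3.+1) i) = OpWait m d.
  by apply: op_step_pending pn _; rewrite E3.
have [|t4 le4 E4] := wait_returns ni erefl pc4.
  exact: (op_wait (inv_op (state_inv_at run_e t3.+1)) pc4).
split; first by exists t4; split; [lia | apply/history_act].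
have [u /delivered_event[t' [ms [_ ? ?]]]] := MEM_eventually_delivered ni mM.
by exists t', ms; split=> //; apply/history_act.
Qed.

Lemma run_termination2 : kscd_termination2 (nonfaulty e) (history_of e).
Proof.
move=> t j ms m /history_act E mms i ni.
have mM : m \in union_entries (MEM (st e t.+1)).
  apply: (fsubsetP (inv_delivered (inv_task (state_inv_at run_e t.+1) j))).
  by rewrite (delivers_delivered (act_delivers run_e E)) inE mms orbT.
have [u /delivered_event[t' [ms' [_ ? ?]]]] := MEM_eventually_delivered ni mM.
by exists t', ms'; split=> //; apply/history_act.
Qed.
End Liveness.
End Specification.

Theorem theorem5 (n k : nat) (M : choiceType) (n_gt0 : 0 < n) (k_gt0 : 0 < k)
    (e : execution n M)
    (run_e : is_run k e)
    (distinct_e : distinct_broadcasts (history_of e)) :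
  one_shot_use e /\
  kscd_broadcast_spec k (nonfaulty e) (history_of e).
Proof.
split; first exact: runs_one_shot run_e.
have [ne va int ord bnd] := run_safety run_e.
split=> //; first exact: run_termination1 run_e k_gt0.
exact: run_termination2 run_e k_gt0.
Qed.
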